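(* Let $1<p,q<\infty$ and let $p',q'$ be defined by $\frac1p+\frac1{p'}=1$ and $\frac1q+\frac1{q'}=1$. Then the dual space of $\mathcal{G}_{p,q}(\mathbb{R})$ is $\mathcal{BD}_{p',q'}(\mathbb{R})$: the map $g\mapsto\kappa_g$, where $$\kappa_g(f)=\sum_{k=1}^\infty\mathbb{E}[d_kf\,d_kg]\qquad (f\in\mathcal{G}_{p,q}(\mathbb{R})),$$ is a well-defined linear bijection from $\mathcal{BD}_{p',q'}(\mathbb{R})$ onto the space of continuous linear functionals on $\mathcal{G}_{p,q}(\mathbb{R})$, and the operator norm $\|\kappa_g\|$ is equivalent to $\|g\|_{\mathcal{BD}_{p',q'}(\mathbb{R})}$ (with constants independent of $g$).
   Context: Setting: for $n\in\mathbb{N}=\{0,1,2,\dots\}$, $\mathcal{F}_n$ is the $\sigma$-algebra on $\mathbb{R}$ generated by the dyadic intervals $[k2^{-n},(k+1)2^{-n})$, $k\in\mathbb{Z}$; $\mathcal{F}$ is the $\sigma$-algebra generated by $\bigcup_n\mathcal{F}_n$; $\mathbb{P}$ is a probability measure on $(\mathbb{R},\mathcal{F})$; $\mathbb{E}$ is expectation. Put $A_j=[j,j+1)$, $j\in\mathbb{Z}$. $\mathcal{M}$ is the set of all (real-valued) martingales $f=(f_n)_{n\ge0}$ with respect to $(\mathcal{F}_n)$, with the convention $f_0=0$; $d_nf=f_n-f_{n-1}$ for $n\ge1$ and $d_0f=0$. Amalgam norm: $\|f\|_{L_{p,q}(\mathbb{R})}=\left(\sum_{j\in\mathbb{Z}}\left(\int_{A_j}|f|^p\,d\mathbb{P}\right)^{q/p}\right)^{1/q}$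 for $0<p,q<\infty$. $\mathcal{G}_{p,q}(\mathbb{R})$ is the space of $f\in\mathcal{M}$ with $\|f\|_{\mathcal{G}_{p,q}(\mathbb{R})}:=\left\|\sum_{n=0}^\infty|d_nf|\right\|_{L_{p,q}(\mathbb{R})}<\infty$, and $\mathcal{BD}_{p,q}(\mathbb{R})$ is the space of $f\in\mathcal{M}$ with $\|f\|_{\mathcal{BD}_{p,q}(\mathbb{R})}:=\left\|\sup_{n\in\mathbb{N}}|d_nf|\right\|_{L_{p,q}(\mathbb{R})}<\infty$.
   Formalization: Martingales need only be integrable on each [j,j+1), not on all of R, in both G_{p,q} and BD_{p',q'}; with global integrability surjectivity fails for some P when q<p. Injectivity is understood up to almost sure equality. *)

(* Defs.v *)
From HB Require Import structures.
From mathcomp Require Import all_boot all_order all_algebra.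
From mathcomp Require Import all_classical all_reals all_analysis.
Set Implicit Arguments.
Unset Strict Implicit.
Unset Printing Implicit Defensive.
Import Order.TTheory GRing.Theory Num.Theory.
Import numFieldNormedType.Exports.
Local Open Scope classical_set_scope.
Local Open Scope ring_scope.

Section Filtration.
Variable R : realType.

Definition dyadic_interval (n : nat) (k : int) : set R :=
  [set` `[k%:~R / 2 ^+ n, (k + 1)%:~R / 2 ^+ n[].

Definition dyadic_algebra (n : nat) : set (set R) :=
  <<s range (dyadic_interval n) >>.

Definition dyadic_level (n : nat) := g_sigma_algebraType (range (dyadic_interval n)).

Definition dyadic_line := g_sigma_algebraType (\bigcup_n dyadic_algebra n).

Definition unit_itv (j : int) : set R := [set` `[j%:~R, (j + 1)%:~R[].

End Filtration.

Arguments dyadic_interval R n k : clear implicits.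
Arguments dyadic_algebra R n : clear implicits.
Arguments unit_itv R j : clear implicits.

Section Spaces.
Variables (R : realType) (P : probability (dyadic_line R) R).

Notation T := (dyadic_line R).

(* [X] is a version of the conditional expectation of [Y] given the n-th
   dyadic algebra.  As usual for spaces localised over the atoms [j, j+1) of
   the initial sigma-algebra, [X] and [Y] are required to be integrable on
   each of these atoms and the averages are compared on the sets below them.
   When [X] and [Y] are integrable on the whole line this is the ordinary
   conditional expectation; integrability on the whole line is not imposed,
   since functions with finite amalgam norm are integrable on each [j, j+1)
   but need not be integrable on R when the outer exponent is larger than
   the inner one. *)
Definition is_cond_exp (n : nat) (X Y : T -> R) : Prop :=
  [/\ measurable_fun [set: dyadic_level R n] (X : dyadic_level R n -> R),
      forall j, P.-integrable (unit_itv R j) (EFin \o X),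
      forall j, P.-integrable (unit_itv R j) (EFin \o Y) &
      forall (B : set T) (j : int), dyadic_algebra R n B ->
        (\int[P]_(x in B `&` unit_itv R j) (Y x)%:E =
         \int[P]_(x in B `&` unit_itv R j) (X x)%:E)%E].

Definition is_martingale (f : nat -> T -> R) : Prop :=
  f 0%N = 0 /\ forall n, is_cond_exp n (f n) (f n.+1).

Definition mdiff (f : nat -> T -> R) (n : nat) : T -> R :=
  if n is m.+1 then f m.+1 - f m else 0.

Definition eq_as (f g : nat -> T -> R) : Prop :=
  forall n, {ae P, forall x, f n x = g n x}.

Definition amalgam_norm (p q : R) (F : T -> \bar R) : \bar R :=
  ((\esum_(j in [set: int])
      (\int[P]_(x in unit_itv R j) (`|F x| `^ p)) `^ (q / p)%R) `^ (q^-1)%R)%E.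

Definition G_norm (p q : R) (f : nat -> T -> R) : \bar R :=
  amalgam_norm p q (fun x => \sum_(0 <= n <oo) `|mdiff f n x|%:E)%E.

Definition BD_norm (p q : R) (f : nat -> T -> R) : \bar R :=
  amalgam_norm p q (fun x => ereal_sup (range (fun n => `|mdiff f n x|%:E))).

Definition G_space (p q : R) : set (nat -> T -> R) :=
  [set f | is_martingale f /\ (G_norm p q f < +oo)%E].

Definition BD_space (p q : R) : set (nat -> T -> R) :=
  [set f | is_martingale f /\ (BD_norm p q f < +oo)%E].

(* Processes are not quotiented by almost sure equality.  Functionals are
   total functions of which only the values on [G_space p q] matter; those
   below are invariant under [eq_as] there, by linearity and continuity. *)
Definition G_linear (p q : R) (phi : (nat -> T -> R) -> R) : Prop :=
  forall (a : R) (f h : nat -> T -> R), G_space p q f -> G_space p q h ->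
    phi (a *: f + h) = a * phi f + phi h.

Definition G_continuous (p q : R) (phi : (nat -> T -> R) -> R) : Prop :=
  forall f, G_space p q f -> forall e : R, 0 < e ->
  exists2 d : R, 0 < d &
    forall h, G_space p q h -> (G_norm p q (h - f)%R < d%:E)%E ->
      `|phi h - phi f| < e.

Definition G_dual (p q : R) : set ((nat -> T -> R) -> R) :=
  [set phi | G_linear p q phi /\ G_continuous p q phi].

Definition G_opnorm (p q : R) (phi : (nat -> T -> R) -> R) : \bar R :=
  ereal_sup [set `|phi f|%:E | f in
    [set f | G_space p q f /\ (G_norm p q f <= 1)%E]].

Definition kappa_term (g f : nat -> T -> R) (k : nat) : T -> R :=
  fun x => mdiff f k x * mdiff g k x.

Definition kappa (g f : nat -> T -> R) : R :=
  limn (fun n : nat => \sum_(1 <= k < n) fine 'E_P[kappa_term g f k]).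

End Spaces.

(* Main.v *)
Require Import Defs.
From HB Require Import structures.
From mathcomp Require Import all_boot all_order all_algebra.
From mathcomp Require Import all_classical all_reals all_analysis.
From mathcomp Require Import measurable_realfun.
From mathcomp Require Import ring lra zify.
Import Order.TTheory GRing.Theory Num.Theory.
Import numFieldNormedType.Exports.
Set Implicit Arguments.
Unset Strict Implicit.
Unset Printing Implicit Defensive.
Local Open Scope classical_set_scope.
Local Open Scope ring_scope.

(**
  The upper bound is Hoelder's inequality on each [j, j+1) followed by
  Hoelder's inequality for the sum over j.

  For the lower bound no extension theorem is needed. Given N, let
  s = max_(n <= N) |d_n g|, let u be the extremal weight for the amalgam norm
  of s, and let w_n be the restriction of u to the set where the maximum is
  first selected at level n. The martingale f with differences
  d_n f = (E_n - E_(n-1)) (sgn (d_n g) w_n) satisfies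
  kappa_g(f) = E[s u], while the dual Doob inequality
  ||sum_n E_n w_n||_p <= p ||sum_n w_n||_p, applied on each [j, j+1), bounds
  its norm by a constant times that of u. Everything takes place on finitely
  many dyadic intervals, where conditional expectations are finite averages.

  A functional phi is represented by the martingale whose n-th difference on a
  dyadic interval I of level n is phi(f_I) / P(I), where f_I is the martingale
  whose only difference is (E_n - E_(n-1)) 1_I. The identity phi = kappa_g
  then holds on martingales with finitely many differences supported on
  finitely many [j, j+1); the lower bound puts g in BD, and these martingales
  are dense in G.
*)

(** * Power inequalities and the dual Doob inequality *)

(** The extremal weight depends on differences of all levels up to N, so sgn (d_n g) w_n is not
    constant on the dyadic intervals of level n and cannot itself be a martingale difference; E_n -
    E_(n-1) repairs this. Against d_n g the repair is invisible: E_n is self-adjoint and d_n g has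
    level n, while the E_(n-1) part is orthogonal to d_n g. Its cost in norm is bearable because the
    w_n are nonnegative with disjoint supports, so that sum_n w_n <= u. The dual Doob inequality is
    needed twice, once for the E_n and once for the E_(n-1).

    The second obstacle is that P may give mass 0 to dyadic intervals while processes are not
    quotiented. Averages over null classes are 0 by convention, so E_n u = u for u of level n is
    only stated after multiplication by the mass, and a functional ignores null changes only thanks
    to its continuity. *)

Section PowerInequalities.
Variable R : realType.
Implicit Types a b p q : R.

Lemma conjugate_exponentE p q : 1 < p -> p^-1 + q^-1 = 1 ->
  [/\ 0 < q, (q - 1) * p = q & (p - 1) * q = p].
Proof.
move=> p1 pq; have p0 : 0 < p by rewrite (lt_trans _ p1).
have q0 : 0 < q.
  rewrite -invr_gt0; have -> : q^-1 = 1 - p^-1 by rewrite -pq addrC addKr.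
  by rewrite subr_gt0 invf_lt1.
have E : p + q = p * q.
  have pn : p != 0 by rewrite gt_eqF.
  have qn : q != 0 by rewrite gt_eqF.
  have : (p^-1 + q^-1) * (p * q) = p * q by rewrite pq mul1r.
  rewrite mulrDl mulrA mulVf// mul1r (mulrC p q) mulrA mulVf// mul1r => <-.
  by rewrite addrC.
by split=> //; rewrite mulrBl mul1r ?(mulrC q) -E; ring.
Qed.

(** Convexity of t^p at the point b, obtained from Young's inequality for a and b^(p-1) with
    exponents p and p/(p-1). *)
Lemma powR_sub_le p a b : 1 < p -> 0 <= a -> a <= b ->
  b `^ p - a `^ p <= p * ((b - a) * b `^ (p - 1)).
Proof.
move=> p1 a0 ab; have b0 : 0 <= b by exact: le_trans ab.
have p0 : 0 < p by rewrite (lt_trans _ p1).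
pose q := p / (p - 1).
have pB0 : 0 < p - 1 by rewrite subr_gt0.
have q0 : 0 < q by rewrite divr_gt0.
have pq : p^-1 + q^-1 = 1.
  by rewrite /q invf_div; field; rewrite gt_eqF.
have := conjugate_powR a0 (powR_ge0 b (p - 1)) p0 q0 pq.
rewrite -powRrM (_ : (p - 1) * q = p); last by rewrite /q mulrC divfK // gt_eqF.
move=> H.
have {H} : p * (a * b `^ (p - 1)) <= a `^ p + (p - 1) * b `^ p.
  have := ler_wpM2l (ltW p0) H; rewrite mulrDr [p * (a `^ p / p)]mulrC divfK ?gt_eqF//.
  by rewrite (_ : p * (b `^ p / q) = (p - 1) * b `^ p) // /q invf_div; field;
     rewrite !gt_eqF.
have := mulr_powRB1 b0 p0; nra.
Qed.

(** Write t^p as t t^(p-1) and use that t^(p-1) is nondecreasing. *)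
Lemma powRD_superadditive p a b : 1 < p -> 0 <= a -> 0 <= b ->
  a `^ p + b `^ p <= (a + b) `^ p.
Proof.
move=> p1 a0 b0; have p0 : 0 < p by rewrite (lt_trans _ p1).
have ab0 := addr_ge0 a0 b0; have pB0 : 0 <= p - 1 by rewrite subr_ge0 ltW.
rewrite -(mulr_powRB1 a0 p0) -(mulr_powRB1 b0 p0) -(mulr_powRB1 ab0 p0).
by rewrite mulrDl lerD// ler_wpM2l// ge0_ler_powR// ?nnegrE// (lerDl, lerDr).
Qed.

Lemma powRD_le2 p a b : 0 <= p -> 0 <= a -> 0 <= b ->
  (a + b) `^ p <= 2 `^ p * (a `^ p + b `^ p).
Proof.
move=> p0; wlog ab : a b / a <= b.
  move=> W a0 b0; have [ab|/ltW ba] := leP a b; first exact: W.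
  by rewrite addrC [X in _ * X]addrC; apply: W.
move=> a0 b0; rewrite (@le_trans _ _ (2 `^ p * b `^ p))//.
  rewrite -powRM// ge0_ler_powR// ?nnegrE ?addr_ge0 ?mulr_ge0//; lra.
by rewrite ler_wpM2l ?powR_ge0// lerDr powR_ge0.
Qed.

Lemma powR_invK p a : 0 < p -> 0 <= a -> (a `^ p^-1) `^ p = a.
Proof. by move=> p0 a0; rewrite -powRrM mulVf ?gt_eqF// powRr1. Qed.

Lemma powRK_inv p a : 0 < p -> 0 <= a -> (a `^ p) `^ p^-1 = a.
Proof. by move=> p0 a0; rewrite -powRrM mulfV ?gt_eqF// powRr1. Qed.

(** Induction on the list: the two-term inequality is applied to the head and to the two norms of
    the tail. *)
Lemma hoelder_sum (I : Type) (r : seq I) (a b : I -> R) p q :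
  (forall i, 0 <= a i) -> (forall i, 0 <= b i) ->
  0 < p -> 0 < q -> p^-1 + q^-1 = 1 ->
  \sum_(i <- r) a i * b i <=
  (\sum_(i <- r) a i `^ p) `^ p^-1 * (\sum_(i <- r) b i `^ q) `^ q^-1.
Proof.
move=> a0 b0 p0 q0 pq; elim: r => [|i r IH].
  by rewrite !big_nil mulr_ge0// powR_ge0.
rewrite !big_cons; move: IH; set A := \sum_(_ <- _) _ `^ p; set B := \sum_(_ <- _) _ `^ q.
have A0 : 0 <= A by apply: sumr_ge0 => j _; exact: powR_ge0.
have B0 : 0 <= B by apply: sumr_ge0 => j _; exact: powR_ge0.
clearbody A B => IH.
have := hoelder2 (a0 i) (powR_ge0 A p^-1) (b0 i) (powR_ge0 B q^-1) p0 q0 pq.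
rewrite (powR_invK p0 A0) (powR_invK q0 B0) => H.
by apply: le_trans H; rewrite lerD2l.
Qed.

End PowerInequalities.

Section WeightedFiniteSet.
Variables (R : realType) (T : finType) (K : eqType) (m : T -> R).
Hypothesis m0 : forall t, 0 <= m t.
Implicit Types (c : T -> K) (u v w : T -> R).

(* A class of mass 0 gets the mean 0, since division by 0 gives 0. *)
Definition class_mean c u (k : K) : R :=
  (\sum_(s | c s == k) m s * u s) / (\sum_(s | c s == k) m s).

Lemma class_mean_ge0 c u k : (forall t, 0 <= u t) -> 0 <= class_mean c u k.
Proof. by move=> u0; rewrite divr_ge0 ?sumr_ge0// => t _; rewrite mulr_ge0. Qed.

(** Both sides are double sums over pairs (t, s) in the same class, with the symmetric kernel m t m
    s / M, where M is the mass of that class. *)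
Lemma class_mean_selfadjoint c u v :
  \sum_t m t * (u t * class_mean c v (c t)) =
  \sum_t m t * (class_mean c u (c t) * v t).
Proof.
pose M k := \sum_(s | c s == k) m s.
have L w z : \sum_t m t * (w t * class_mean c z (c t)) =
    \sum_t \sum_(s | c s == c t) m t * w t * (m s * z s) / M (c t).
  apply: eq_bigr => t _; rewrite /class_mean mulrA mulrA mulr_sumr.
  by rewrite mulr_suml; apply: eq_bigr.
have -> : \sum_t m t * (class_mean c u (c t) * v t) =
    \sum_t m t * (v t * class_mean c u (c t)).
  by apply: eq_bigr => t _; rewrite (mulrC (v t)).
rewrite !L (exchange_big_dep xpredT)//=; apply: eq_bigr => t _.
apply: eq_big => [s|s /eqP <-]; first by rewrite eq_sym.
by ring.
Qed.

(** The factor [m t] rescues null classes: there the mean is 0 whatever [u] is, but [m t] vanishes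
    too because all masses are nonnegative. *)
Lemma mass_class_mean c u t : (forall s, c s = c t -> u s = u t) ->
  m t * class_mean c u (c t) = m t * u t.
Proof.
move=> uc; rewrite /class_mean.
have -> : \sum_(s | c s == c t) m s * u s = (\sum_(s | c s == c t) m s) * u t.
  by rewrite mulr_suml; apply: eq_bigr => s /eqP /uc ->.
have [M0|M0] := eqVneq (\sum_(s | c s == c t) m s) 0; last first.
  by rewrite mulrAC divff// mul1r.
have -> : m t = 0; last by rewrite !mul0r.
apply/eqP; move/eqP: M0; rewrite psumr_eq0// => /allP /(_ t).
by rewrite mem_index_enum eqxx => /(_ isT).
Qed.

Lemma sum_class_mean c u v : (forall s t, c s = c t -> u s = u t) ->
  \sum_t m t * (class_mean c v (c t) * u t) = \sum_t m t * (v t * u t).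
Proof.
move=> uc; rewrite -class_mean_selfadjoint; apply: eq_bigr => t _.
rewrite mulrCA mass_class_mean; first by ring.
by move=> s; exact: uc.
Qed.

(* With [W_n] the partial sums, [W_N^p <= p sum_n (W_n - W_(n-1)) W_n^(p-1)];
   [W_n] is constant on the n-th classes, so that the means may be dropped from
   the increments after integration, and Hoelder's inequality concludes. *)
Lemma dual_doob (p : R) (c : nat -> T -> K) (w : nat -> T -> R) (N : nat) :
  1 < p ->
  (forall n s t, c n.+1 s = c n.+1 t -> c n s = c n t) ->
  (forall n t, 0 <= w n t) ->
  \sum_t m t * (\sum_(n < N) class_mean (c n) (w n) (c n t)) `^ p <=
  p `^ p * \sum_t m t * (\sum_(n < N) w n t) `^ p.
Proof.
move=> p1 cS w0; have p0 : 0 < p by rewrite (lt_trans _ p1).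
have pn0 : p != 0 by rewrite gt_eqF.
have pB0 : 0 < p - 1 by rewrite subr_gt0.
pose q := p / (p - 1).
have q0 : 0 < q by rewrite divr_gt0.
have pq : p^-1 + q^-1 = 1.
  by rewrite /q invf_div; field; rewrite gt_eqF.
pose W n t := \sum_(k < n) class_mean (c k) (w k) (c k t).
have W0 n t : 0 <= W n t by rewrite sumr_ge0// => k _; exact: class_mean_ge0.
have WS n t : W n.+1 t = W n t + class_mean (c n) (w n) (c n t).
  by rewrite /W big_ord_recr.
have Wle n k t : (n <= k)%N -> W n t <= W k t.
  move=> nk; rewrite -(subnKC nk); elim: (k - n)%N => [|i IH].
    by rewrite addn0.
  by rewrite addnS WS (le_trans IH)// lerDl class_mean_ge0.
have cle n k s t : (n <= k)%N -> c k s = c k t -> c n s = c n t.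
  move=> nk; rewrite -(subnKC nk); elim: (k - n)%N => [|i IH].
    by rewrite addn0.
  by rewrite addnS => /cS.
have Wc n s t : c n s = c n t -> W n.+1 s = W n.+1 t.
  move=> st; apply: eq_bigr => k _.
  by rewrite (cle _ _ _ _ _ st)// -ltnS.
set A := \sum_t m t * _ `^ p.
set B := \sum_t m t * (\sum_(n < N) w n t) `^ p.
have A0 : 0 <= A by rewrite sumr_ge0// => t _; rewrite mulr_ge0// powR_ge0.
have B0 : 0 <= B by rewrite sumr_ge0// => t _; rewrite mulr_ge0// powR_ge0.
have step : A <= p * \sum_t m t * ((\sum_(n < N) w n t) * W N t `^ (p - 1)).
  have -> : A = \sum_(n < N) \sum_t m t * (W n.+1 t `^ p - W n t `^ p).
    rewrite exchange_big /=; apply: eq_bigr => t _.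
    rewrite -mulr_sumr; congr (_ * _).
    rewrite -(big_mkord xpredT (fun n => W n.+1 t `^ p - W n t `^ p)).
    by rewrite telescope_sumr// [W 0%N t]/W big_ord0 powR0// subr0.
  have -> : p * (\sum_t m t * ((\sum_(n < N) w n t) * W N t `^ (p - 1))) =
      \sum_(n < N) p * \sum_t m t * (w n t * W N t `^ (p - 1)).
    rewrite -mulr_sumr exchange_big; congr (_ * _); apply: eq_bigr => t _.
    by rewrite -mulr_sumr mulr_suml.
  apply: ler_sum => n _.
  apply: (@le_trans _ _ (p * \sum_t m t * (w n t * W n.+1 t `^ (p - 1)))).
    rewrite -(@sum_class_mean (c n) (fun t => W n.+1 t `^ (p - 1)) (w n)).
      rewrite mulr_sumr; apply: ler_sum => t _; rewrite mulrCA ler_wpM2l//.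
      have := powR_sub_le p1 (W0 n t) (Wle _ _ _ (leqnSn n)).
      by rewrite [W n.+1 t - _](_ : _ = class_mean (c n) (w n) (c n t)) // WS addrAC subrr add0r.
    by move=> s t /Wc ->.
  apply: (ler_wpM2l (ltW p0)); apply: ler_sum => t _.
  apply: ler_wpM2l => //; apply: ler_wpM2l => //.
  by apply: ge0_ler_powR; rewrite ?nnegrE ?(ltW pB0)// Wle.
have hold : \sum_t m t * ((\sum_(n < N) w n t) * W N t `^ (p - 1)) <=
    B `^ p^-1 * A `^ q^-1.
  (* The mass is split as m^(1/p) m^(1/q), which reduces the weighted inequality to the unweighted
     one. *)
  have := @hoelder_sum R T (index_enum T)
    (fun t => m t `^ p^-1 * \sum_(n < N) w n t)
    (fun t => m t `^ q^-1 * W N t `^ (p - 1)) p q _ _ p0 q0 pq.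
  have E1 : \sum_t (m t `^ p^-1 * \sum_(n < N) w n t) `^ p = B.
    apply: eq_bigr => t _; rewrite powRM ?powR_ge0//; last exact: sumr_ge0.
    by rewrite -powRrM mulVf// powRr1.
  have E2 : \sum_t (m t `^ q^-1 * W N t `^ (p - 1)) `^ q = A.
    apply: eq_bigr => t _; rewrite powRM ?powR_ge0// -!powRrM.
    by rewrite mulVf ?gt_eqF// powRr1// /q mulrCA divff ?mulr1// gt_eqF.
  rewrite E1 E2 => H; apply: le_trans (H _ _).
  - apply: ler_sum => t _; rewrite mulrACA -powRD.
      by rewrite pq powRr1.
    by rewrite pq oner_eq0.
  - by move=> t; rewrite mulr_ge0 ?powR_ge0//; exact: sumr_ge0.
  - by move=> t; rewrite mulr_ge0 ?powR_ge0.
have {step hold} H : A <= p * (B `^ p^-1 * A `^ q^-1).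
  by apply: le_trans step _; rewrite ler_wpM2l// ltW.
clearbody A B.
(* [A] occurs on both sides of [H]; once it is nonzero, the finite factor A^(1/q) can be
   cancelled. *)
have [->|An0] := eqVneq A 0; first by rewrite mulr_ge0// powR_ge0.
have Apos : 0 < A by rewrite lt_neqAle eq_sym An0.
have {}H : A `^ p^-1 <= p * B `^ p^-1.
  rewrite -(@ler_pM2r _ (A `^ q^-1)) ?powR_gt0// -powRD ?pq ?oner_eq0//.
  by rewrite powRr1// -mulrA.
have : (A `^ p^-1) `^ p <= (p * B `^ p^-1) `^ p.
  apply: ge0_ler_powR H; rewrite ?nnegrE ?(ltW p0)//; first exact: powR_ge0.
  by rewrite mulr_ge0 ?powR_ge0 ?(ltW p0).
by rewrite (powRM _ (ltW p0) (powR_ge0 _ _)) (powR_invK p0 A0) (powR_invK p0 B0).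
Qed.

End WeightedFiniteSet.

(** * Functions constant on dyadic intervals *)

Section DyadicIndex.
Variable R : realType.
Implicit Types (x y : R) (n m : nat) (j k : int).

(** The number of the dyadic interval of level n that contains x. Membership in intervals and in the
    dyadic algebras thereby becomes equality of integers. *)
Definition idx n x : int := Num.floor (2 ^+ n * x).

Definition atom n j (i : nat) : int := j * (2 ^ n)%N%:Z + i%:Z.

Definition pt n k : R := k%:~R / 2 ^+ n.

Lemma exp2_gt0 n : 0 < 2 ^+ n :> R.
Proof. by rewrite exprn_gt0. Qed.

Lemma idx_eqP n k x : (idx n x = k) <-> (k%:~R <= 2 ^+ n * x < (k + 1)%:~R).
Proof.
by rewrite /idx -floor_eq; split=> [->|/eqP//]; rewrite eqxx.
Qed.

Lemma dyadic_intervalE n k : dyadic_interval R n k = [set x | idx n x = k].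
Proof.
rewrite predeqE => x; rewrite /dyadic_interval /= in_itv/=.
rewrite ler_pdivrMr ?exp2_gt0// ltr_pdivlMr ?exp2_gt0// mulrC.
by split=> /idx_eqP.
Qed.

Lemma unit_itvE j : unit_itv R j = [set x | idx 0 x = j].
Proof. by rewrite -dyadic_intervalE /dyadic_interval expr0 !divr1. Qed.

Lemma idx_pt n k : idx n (pt n k) = k.
Proof.
apply/idx_eqP; rewrite mulrC divfK ?gt_eqF ?exp2_gt0// lexx ltr_int.
by rewrite ltzD1 lexx.
Qed.

(** If [idx n w < idx n z], then the integer 2^(m-n) [idx n z] is at most 2^m z and exceeds 2^m w,
    so it separates the two indices of level m. *)
Lemma idx_coarser n m x y : (n <= m)%N -> idx m x = idx m y -> idx n x = idx n y.
Proof.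
move=> nm; suff H z w : idx m z = idx m w -> (idx n z <= idx n w)%R.
  by move=> e; apply/eqP; rewrite eq_le !H.
move=> e; rewrite leNgt; apply/negP => lt.
have /idx_eqP/andP[a1 _] : idx n z = idx n z by [].
have /idx_eqP/andP[_ b2] : idx n w = idx n w by [].
have /idx_eqP/andP[_ c2] := e.
have /idx_eqP/andP[d1 _] : idx m w = idx m w by [].
have E : (2 ^+ m = 2 ^+ (m - n)%N * 2 ^+ n :> R)%R by rewrite -exprD subnK.
have p0 := exp2_gt0 (m - n)%N.
have F : ((2 ^ (m - n))%N%:Z * idx n z)%:~R <= 2 ^+ m * z.
  by rewrite intrM -pmulrn natrX E -mulrA ler_pM2l.
have G : 2 ^+ m * w < ((2 ^ (m - n))%N%:Z * idx n z)%:~R.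
  rewrite E -mulrA intrM -pmulrn natrX ltr_pM2l// (lt_le_trans b2)//.
  by rewrite ler_int lezD1.
have : ((idx m w) < (2 ^ (m - n))%N%:Z * idx n z)%R.
  by rewrite -(ltr_int R); apply: le_lt_trans G.
have : ((2 ^ (m - n))%N%:Z * idx n z < idx m w + 1)%R.
  by rewrite -(ltr_int R); apply: le_lt_trans c2.
by rewrite ltzD1 leNgt => /negbTE ->.
Qed.

Lemma idx0_atom n j i x : (i < 2 ^ n)%N -> idx n x = atom n j i -> idx 0 x = j.
Proof.
move=> i2 /idx_eqP/andP[h1 h2]; apply/idx_eqP; rewrite expr0 mul1r.
have p0 := exp2_gt0 n.
rewrite -(ler_pM2l p0) -(ltr_pM2l p0).
have E k : (k * (2 ^ n)%N%:Z)%:~R = 2 ^+ n * k%:~R :> R.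
  by rewrite intrM -pmulrn natrX mulrC.
rewrite -!E; apply/andP; split.
  by apply: le_trans h1; rewrite ler_int /atom; lia.
by apply: lt_le_trans h2 _; rewrite ler_int /atom; nia.
Qed.

Lemma idx_atom n x : exists i : 'I_(2 ^ n), idx n x = atom n (idx 0 x) i.
Proof.
have /idx_eqP : idx 0 x = idx 0 x by [].
rewrite expr0 mul1r => /andP[h1 h2].
have /idx_eqP/andP[g1 g2] : idx n x = idx n x by [].
have p0 := exp2_gt0 n.
have E k : (k * (2 ^ n)%N%:Z)%:~R = 2 ^+ n * k%:~R :> R.
  by rewrite intrM -pmulrn natrX mulrC.
have l1 : (idx 0 x * (2 ^ n)%N%:Z < idx n x + 1)%R.
  by rewrite -(ltr_int R) E (le_lt_trans _ g2)// ler_pM2l.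
have l2 : (idx n x < (idx 0 x + 1) * (2 ^ n)%N%:Z)%R.
  by rewrite -(ltr_int R) E (le_lt_trans g1)// ltr_pM2l.
have lt : (absz (idx n x - idx 0 x * (2 ^ n)%N%:Z)%R < 2 ^ n)%N by lia.
by exists (Ordinal lt); rewrite /atom /=; lia.
Qed.

(** The codomain is arbitrary so that sets, as maps into [Prop], are covered along with real
    functions. *)
Definition level (V : Type) n (u : R -> V) :=
  forall x y, idx n x = idx n y -> u x = u y.

Lemma level_le (V : Type) n m (u : R -> V) : (n <= m)%N -> level n u -> level m u.
Proof. by move=> nm Lu x y /(idx_coarser nm) /Lu. Qed.

Lemma level_comp (V W : Type) n (f : V -> W) (u : R -> V) :
  level n u -> level n (fun x => f (u x)).
Proof. by move=> Lu x y /Lu ->. Qed.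

Lemma level_comp2 (V1 V2 W : Type) n (f : V1 -> V2 -> W)
    (u1 : R -> V1) (u2 : R -> V2) :
  level n u1 -> level n u2 -> level n (fun x => f (u1 x) (u2 x)).
Proof. by move=> L1 L2 x y xy; rewrite (L1 x y) ?(L2 x y). Qed.

Lemma level_sum n (I : Type) (r : seq I) (Q : pred I) (u : I -> R -> R) :
  (forall i, Q i -> level n (u i)) -> level n (fun x => \sum_(i <- r | Q i) u i x).
Proof. by move=> Lu x y xy; apply: eq_bigr => i /Lu/(_ _ _ xy). Qed.

Lemma dyadic_algebra_atom n k : dyadic_algebra R n [set x | idx n x = k].
Proof.
by rewrite -dyadic_intervalE; apply: sub_sigma_algebra; exists k.
Qed.

(** The generators form a countable partition, so the generated sigma-algebra consists of all unions
    of its blocks; the left endpoint [pt n k] decides whether the k-th block belongs to the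
    union. *)
Lemma dyadic_algebraE n B : dyadic_algebra R n B <-> level n B.
Proof.
split.
  apply: (@smallest_sub _ (sigma_algebra setT) _ (fun B : set R => level n B)).
    split=> [//|A LA|F LF].
      by move=> x y xy; rewrite /setD /= (LA x y xy).
    move=> x y xy; apply/propext; split=> -[i _ Fi]; exists i => //.
      by rewrite -(LF i x y xy).
    by rewrite (LF i x y xy).
  move=> _ [k _ <-]; rewrite dyadic_intervalE => x y xy /=.
  by rewrite xy.
move=> LB.
have -> : B = \bigcup_(k : int)
    ([set x | idx n x = k] `&` [set x | B (pt n k)]).
  apply/seteqP; split=> [x Bx|x [k _ [/= <-]]].
    by exists (idx n x) => //; split => //=; rewrite (LB _ x)// idx_pt.
  by rewrite (LB _ x)// idx_pt.
apply: (@countable_bigcupT_measurable _ (dyadic_level R n)) => // k.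
have [Bk|nBk] := pselect (B (pt n k)).
  rewrite (_ : [set _ | B _] = setT) ?setIT; first exact: dyadic_algebra_atom.
  by apply/seteqP; split.
rewrite (_ : [set _ | B _] = set0) ?setI0; first exact: measurable0.
by apply/seteqP; split.
Qed.

Lemma level_measurableP n (u : R -> R) :
  measurable_fun [set: dyadic_level R n] (u : dyadic_level R n -> R) <-> level n u.
Proof.
split=> [mu x y xy|Lu _ Y mY].
  have := mu measurableT [set u x] (measurable_set1 _).
  rewrite setTI => /dyadic_algebraE/(_ x y xy) /=.
  by rewrite /preimage /= => e; apply/esym; rewrite -e.
by rewrite setTI; apply/dyadic_algebraE => x y /Lu; rewrite /preimage /= => ->.
Qed.

Lemma measurable_dyadic n (B : set R) :
  dyadic_algebra R n B -> @measurable _ (dyadic_line R) B.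
Proof. by move=> mB; apply: sub_sigma_algebra; exists n. Qed.

Lemma measurable_level n (u : R -> R) (D : set (dyadic_line R)) :
  level n u -> measurable_fun D (u : dyadic_line R -> R).
Proof.
move=> Lu mD Y mY; apply: measurableI => //; apply: (@measurable_dyadic n).
by apply/dyadic_algebraE => x y /Lu; rewrite /preimage /= => ->.
Qed.

Lemma measurable_unit_itv j : @measurable _ (dyadic_line R) (unit_itv R j).
Proof.
by rewrite unit_itvE; apply: (@measurable_dyadic 0); exact: dyadic_algebra_atom.
Qed.

Lemma measurable_atom n k :
  @measurable _ (dyadic_line R) [set x | idx n x = k].
Proof. by apply: (@measurable_dyadic n); exact: dyadic_algebra_atom. Qed.

End DyadicIndex.

Arguments pt {R} n k.

Section LevelIntegrals.
Variables (R : realType) (P : probability (dyadic_line R) R).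
Implicit Types (n N : nat) (j k : int) (u v : R -> R).

Definition atom_mass n j (i : 'I_(2 ^ n)) : R := fine (P [set x | idx n x = atom n j i]).

Definition atom_pt n j (i : 'I_(2 ^ n)) : R := pt n (atom n j i).

(* The integral over [j, j+1) of a function that is constant on the dyadic
   intervals of length 2^-n. *)
Definition unit_integral n j u : R := \sum_(i < 2 ^ n) atom_mass j i * u (atom_pt j i).

Lemma atom_mass_ge0 n j (i : 'I_(2 ^ n)) : 0 <= atom_mass j i.
Proof. by rewrite fine_ge0. Qed.

Lemma idx_atom_pt n j (i : 'I_(2 ^ n)) : idx n (atom_pt j i) = atom n j i.
Proof. by rewrite idx_pt. Qed.

Lemma idx0_atom_pt n j (i : 'I_(2 ^ n)) : idx 0 (atom_pt j i) = j.
Proof. exact: idx0_atom (ltn_ord i) (idx_atom_pt j i). Qed.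

Lemma unit_itv_atoms n j : unit_itv R j =
  \big[setU/set0]_(i <- index_enum 'I_(2 ^ n)) [set x | idx n x = atom n j i].
Proof.
rewrite unit_itvE -bigcup_seq; apply/seteqP; split=> [x /= <-|x [i _ /=]].
  by have [i e] := idx_atom n x; exists i; rewrite //= mem_index_enum.
by move=> e; exact: idx0_atom (ltn_ord i) e.
Qed.

Lemma integral_level n j u : level n u ->
  (\int[P]_(x in unit_itv R j) (u x)%:E = (unit_integral n j u)%:E)%E.
Proof.
move=> Lu; rewrite (unit_itv_atoms n).
rewrite integral_bigsetU_EFin.
- rewrite /unit_integral -sumEFin; apply: eq_bigr => i _.
  rewrite (eq_integral (cst (u (atom_pt j i))%:E)); last first.
    by move=> x; rewrite inE /= => e; congr (_%:E); apply: Lu; rewrite idx_atom_pt.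
  rewrite integral_cst; last exact: measurable_atom.
  by rewrite EFinM muleC /atom_mass fineK// fin_num_measure//; exact: measurable_atom.
- by move=> i; exact: measurable_atom.
- exact: index_enum_uniq.
- move=> a b _ _ [x [/= -> /eqP]]; rewrite /atom => /eqP e.
  by apply: val_inj => /=; lia.
- by apply/measurable_EFinP; exact: measurable_level Lu.
Qed.

Lemma integrable_level n j u : level n u ->
  P.-integrable (unit_itv R j) (EFin \o u).
Proof.
move=> Lu; apply: measurable_bounded_integrable.
- exact: measurable_unit_itv.
- exact: (le_lt_trans (probability_le1 P (measurable_unit_itv j)) (ltry _)).
- exact: measurable_level Lu.
- exists (\sum_(i < 2 ^ n) `|u (atom_pt j i)|); split; first exact: num_real.
  move=> M ltM x; rewrite unit_itvE /= => xj.
  have [i e] := idx_atom n x; rewrite xj in e.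
  rewrite (Lu x (atom_pt j i)) ?idx_atom_pt//; apply: le_trans (ltW ltM).
  by rewrite (bigD1 i)//= lerDl sumr_ge0.
Qed.

(** Both sums compute the same integral, so no regrouping of atoms is required. *)
Lemma unit_integral_level n N j u : (n <= N)%N -> level n u ->
  unit_integral N j u = unit_integral n j u.
Proof.
move=> nN Lu; apply: EFin_inj.
by rewrite -(integral_level j (level_le nN Lu)) (integral_level j Lu).
Qed.

Lemma eq_unit_integral n j u v : (forall x, idx 0 x = j -> u x = v x) ->
  unit_integral n j u = unit_integral n j v.
Proof. by move=> uv; apply: eq_bigr => i _; rewrite uv// idx0_atom_pt. Qed.

Lemma unit_integral_ge0 n j u : (forall x, 0 <= u x) -> 0 <= unit_integral n j u.
Proof. by move=> u0; apply: sumr_ge0 => i _; rewrite mulr_ge0// atom_mass_ge0. Qed.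

Lemma le_unit_integral n j u v : (forall x, idx 0 x = j -> u x <= v x) ->
  unit_integral n j u <= unit_integral n j v.
Proof.
by move=> uv; apply: ler_sum => i _; rewrite ler_wpM2l ?atom_mass_ge0// uv// idx0_atom_pt.
Qed.

Lemma unit_integralZ n j c u : unit_integral n j (fun x => c * u x) = c * unit_integral n j u.
Proof. by rewrite /unit_integral mulr_sumr; apply: eq_bigr => i _; rewrite mulrCA. Qed.

Lemma unit_integralD n j u v :
  unit_integral n j (fun x => u x + v x) =
  unit_integral n j u + unit_integral n j v.
Proof. by rewrite /unit_integral -big_split; apply: eq_bigr => i _; rewrite mulrDr. Qed.

Lemma unit_integralB n j u v :
  unit_integral n j (fun x => u x - v x) =
  unit_integral n j u - unit_integral n j v.
Proof. by rewrite /unit_integral -sumrB; apply: eq_bigr => i _; rewrite mulrBr. Qed.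

Lemma unit_integral0 n j : unit_integral n j (fun=> 0) = 0.
Proof. by rewrite /unit_integral big1// => i _; rewrite mulr0. Qed.

Lemma unit_integral_sum n j (I : Type) (r : seq I) (Q : pred I) (u : I -> R -> R) :
  unit_integral n j (fun x => \sum_(i <- r | Q i) u i x) =
  \sum_(i <- r | Q i) unit_integral n j (u i).
Proof.
by rewrite /unit_integral exchange_big; apply: eq_bigr => i _; rewrite mulr_sumr.
Qed.

(** Countable additivity runs over natural numbers, so the integers are coded by [pickle]; numbers
    that code nothing are assigned the empty set and contribute 0. *)
Lemma integral_unit_itvs (G : dyadic_line R -> \bar R) :
  measurable_fun setT G -> (forall x, 0 <= G x)%E ->
  (\int[P]_x G x = \esum_(j in [set: int]) \int[P]_(x in unit_itv R j) G x)%E.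
Proof.
move=> mG G0.
pose F (n : nat) : set (dyadic_line R) :=
  if pickle_inv n is Some j then unit_itv R j else set0.
have FT : \bigcup_n F n = setT.
  rewrite -subTset => x _; exists (pickle (idx 0 x)); first exact: I.
  by rewrite /F pickleK_inv unit_itvE.
rewrite -FT ge0_integral_bigcup//; first last.
- move=> a b _ _ [x []]; rewrite /F.
  case ea : (pickle_inv a) => [i|//]; case eb : (pickle_inv b) => [k|//].
  rewrite !unit_itvE => ei ek.
  have := @pickle_invK int a; have := @pickle_invK int b; rewrite ea eb /= => <- <-.
  by rewrite -ei -ek.
- by rewrite FT.
- move=> n; rewrite /F; case: pickle_inv => [j|] //.
  exact: measurable_unit_itv.
have I0 n : (0 <= \int[P]_(x in F n) G x)%E by exact: integral_ge0.
rewrite nneseries_esumT//.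
rewrite (esumID (range (@pickle int)))// [X in (_ + X)%E]esum1 ?adde0; last first.
  move=> n [_ nr]; rewrite /F; case e : pickle_inv => [j|].
    exfalso; apply: nr; exists j => //.
    by have := @pickle_invK int n; rewrite e.
  by rewrite integral_set0.
rewrite setTI esum_image; first by apply: eq_esum => j _; rewrite /F pickleK_inv.
by move=> a b _ _; exact: (pcan_inj pickleK).
Qed.

End LevelIntegrals.

(** * Martingales over the dyadic filtration *)

Section Martingales.
Variables (R : realType) (P : probability (dyadic_line R) R).
Implicit Types (n N : nat) (j k : int) (u v d : R -> R).

(* The conditional expectation given the n-th dyadic algebra of a function [u]
   that is constant on the dyadic intervals of length 2^-N. *)
Definition cond_mean N n u (x : R) : R :=
  class_mean (@atom_mass R P N (idx 0 x)) (fun i => idx n (atom_pt R (idx 0 x) i))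
    (fun i => u (atom_pt R (idx 0 x) i)) (idx n x).

Lemma level_cond_mean N n u : level n (cond_mean N n u).
Proof.
by move=> x y xy; rewrite /cond_mean (idx_coarser (leq0n n) xy) xy.
Qed.

Lemma cond_mean_atom_pt N n u j (i : 'I_(2 ^ N)) : cond_mean N n u (atom_pt R j i) =
  class_mean (@atom_mass R P N j) (fun i => idx n (atom_pt R j i)) (fun i => u (atom_pt R j i))
    (idx n (atom_pt R j i)).
Proof. by rewrite /cond_mean idx0_atom_pt. Qed.

Lemma cond_mean_ge0 N n u x : (forall y, 0 <= u y) -> 0 <= cond_mean N n u x.
Proof. by move=> u0; apply: class_mean_ge0 => // t; exact: atom_mass_ge0. Qed.

Lemma unit_integral_cond_mean_selfadjoint N n j u v :
  unit_integral P N j (fun x => u x * cond_mean N n v x) =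
  unit_integral P N j (fun x => cond_mean N n u x * v x).
Proof.
rewrite /unit_integral; under eq_bigr do rewrite cond_mean_atom_pt.
under [RHS]eq_bigr do rewrite cond_mean_atom_pt.
exact: (class_mean_selfadjoint (atom_mass P j) (fun i => idx n (atom_pt R j i))).
Qed.

Lemma unit_integral_cond_mean_level N n j u v : level n u ->
  unit_integral P N j (fun x => cond_mean N n u x * v x) = unit_integral P N j (fun x => u x * v x).
Proof.
move=> Lu; apply: eq_bigr => i _; rewrite cond_mean_atom_pt mulrA.
rewrite (mass_class_mean (fun t => atom_mass_ge0 P j t)); first by rewrite -mulrA.
by move=> s /Lu.
Qed.

Lemma cond_mean_eq0 N n d x :
  (forall k, unit_integral P N (idx 0 x) (fun y => (idx n y == k)%:R * d y) = 0) ->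
  cond_mean N n d x = 0.
Proof.
move=> d0; rewrite /cond_mean /class_mean.
rewrite [X in X / _](_ : _ = 0) ?mul0r//.
rewrite -[RHS](d0 (idx n x)) /unit_integral big_mkcond; apply: eq_bigr => i _.
by case: ifP => _; rewrite ?mul1r// mul0r mulr0.
Qed.

(** Since v has level n it may be replaced by its conditional mean, which self-adjointness then
    moves onto d, where it gives 0. *)
Lemma unit_integral_orthogonal N n j v d : level n v ->
  (forall k, unit_integral P N j (fun y => (idx n y == k)%:R * d y) = 0) ->
  unit_integral P N j (fun x => v x * d x) = 0.
Proof.
move=> Lv d0; rewrite -(unit_integral_cond_mean_level _ _ _ Lv).
rewrite -unit_integral_cond_mean_selfadjoint.
rewrite -[RHS](unit_integral0 P N j); apply: eq_unit_integral => x xj.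
by rewrite cond_mean_eq0 ?mulr0// xj.
Qed.

Lemma integral_setI_level n j u (B : set R) : level n u -> level n B ->
  (\int[P]_(x in B `&` unit_itv R j) (u x)%:E =
   (unit_integral P n j (fun x => (x \in B)%:R * u x))%:E)%E.
Proof.
move=> Lu LB; rewrite integral_mkcondl -integral_level; last first.
  move=> x y xy; rewrite (Lu x y xy); congr (_%:R * _).
  by rewrite /in_mem /= /in_set /=; congr asbool; exact: LB.
apply: eq_integral => x _; rewrite /patch.
by case: ifP => _; rewrite ?mul1r ?mul0r.
Qed.

Lemma mdiffS (f : nat -> dyadic_line R -> R) n x :
  mdiff f n.+1 x = f n.+1 x - f n x.
Proof. by []. Qed.

(** Testing on single intervals of level n suffices, because [unit_integral_orthogonal] extends
    orthogonality to the indicator of every set of the n-th algebra. Local integrability is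
    automatic: f_n takes finitely many values on each [j, j+1). *)
Lemma martingaleP (f : nat -> dyadic_line R -> R) : is_martingale P f <->
  [/\ f 0%N = 0, forall n, level n (f n) &
      forall n j k, unit_integral P n.+1 j (fun x => (idx n x == k)%:R * mdiff f n.+1 x) = 0].
Proof.
have sub n j (v : R -> R) : unit_integral P n.+1 j (fun x => v x * mdiff f n.+1 x) =
    unit_integral P n.+1 j (fun x => v x * f n.+1 x) -
    unit_integral P n.+1 j (fun x => v x * f n x).
  by rewrite -unit_integralB; apply: eq_unit_integral => x _; rewrite mdiffS mulrBr.
have Lidx n k : level n [set x : R | idx n x = k] by move=> x y /= ->.
have LI n (B : set R) : level n B -> level n (fun x => (x \in B)%:R : R).
  move=> LB x y xy; congr (_%:R).
  by rewrite /in_mem /= /in_set /=; congr asbool; exact: LB.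
split=> [[f0 fm]|[f0 fL fo]].
  have fL n : level n (f n) by have [/level_measurableP] := fm n.
  split=> // n j k; rewrite sub; apply/eqP; rewrite subr_eq0; apply/eqP.
  have [_ _ _ /(_ [set x | idx n x = k] j (@dyadic_algebra_atom R n k))] := fm n.
  rewrite (integral_setI_level _ (fL n.+1)); last exact: level_le (Lidx n k).
  rewrite (@integral_setI_level n.+1); first last.
  - exact: level_le (Lidx n k).
  - exact: level_le (fL n).
  have E (x : R) : (x \in [set y : R | idx n y = k]) = (idx n x == k) :> bool.
    by apply/idP/eqP; rewrite inE.
  have EE (w : R -> R) :
      unit_integral P n.+1 j (fun x => (x \in [set y : R | idx n y = k])%:R * w x) =
      unit_integral P n.+1 j (fun x => (idx n x == k)%:R * w x).
    by apply: eq_unit_integral => x _; rewrite E.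
  by move=> [H]; rewrite -!EE.
split=> // n; split.
- exact/level_measurableP.
- by move=> j; exact: integrable_level (fL n).
- by move=> j; exact: integrable_level (fL n.+1).
move=> B j /dyadic_algebraE LB.
rewrite (integral_setI_level j (fL n.+1) (level_le (leqnSn n) LB)).
rewrite (integral_setI_level j (level_le (leqnSn n) (fL n)) (level_le (leqnSn n) LB)).
congr (_%:E); apply/eqP; rewrite -subr_eq0 -sub; apply/eqP.
by apply: (unit_integral_orthogonal (LI _ _ LB)) => k; exact: fo.
Qed.

Lemma martingale_level f n : is_martingale P f -> level n (f n).
Proof. by move=> /martingaleP[]. Qed.

Lemma mdiff_level f n : is_martingale P f -> level n (mdiff f n).
Proof.
move=> /martingaleP[_ fL _]; case: n => [|n]; first by [].
apply: (@level_comp2 _ _ _ _ _ (fun a b => a - b)) (fL n.+1) _.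
exact: level_le (fL n).
Qed.

Lemma mdiff_orthogonal f n N j v : is_martingale P f -> (n < N)%N -> level n v ->
  unit_integral P N j (fun x => v x * mdiff f n.+1 x) = 0.
Proof.
move=> fm nN Lv; rewrite (@unit_integral_level _ _ n.+1)//.
  by apply: unit_integral_orthogonal Lv _ => k; case/martingaleP : fm.
exact: (level_comp2 (fun a b => a * b) (level_le (leqnSn n) Lv) (mdiff_level (n := n.+1) fm)).
Qed.

Lemma mdiff0 (f : nat -> dyadic_line R -> R) : mdiff f 0 = 0. Proof. by []. Qed.

Lemma mdiffE_lin a (f h : nat -> dyadic_line R -> R) n x :
  mdiff (a *: f + h) n x = a * mdiff f n x + mdiff h n x.
Proof.
case: n => [|n]; first by rewrite !mdiff0 /= mulr0 addr0.
have E m : (a *: f + h) m x = a * f m x + h m x by [].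
by rewrite !mdiffS !E; ring.
Qed.

Lemma mdiffE_sub (f h : nat -> dyadic_line R -> R) n x :
  mdiff (f - h) n x = mdiff f n x - mdiff h n x.
Proof.
case: n => [|n]; first by rewrite !mdiff0 /= subrr.
have E m : (f - h) m x = f m x - h m x by [].
by rewrite !mdiffS !E; ring.
Qed.

Lemma martingale_lin a f h : is_martingale P f -> is_martingale P h ->
  is_martingale P (a *: f + h).
Proof.
move=> /martingaleP[f0 fL fo] /martingaleP[h0 hL ho]; apply/martingaleP; split.
- apply/funext => x; have -> : (a *: f + h) 0%N x = a * f 0%N x + h 0%N x by [].
  have [-> ->] : f 0%N x = 0 /\ h 0%N x = 0 by rewrite f0 h0.
  by rewrite mulr0 addr0.

- by move=> n; exact: (level_comp2 (fun b c => a * b + c) (fL n) (hL n)).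
- move=> n j k; rewrite (@eq_unit_integral _ _ _ _ _ (fun x =>
      a * ((idx n x == k)%:R * mdiff f n.+1 x) +
      (idx n x == k)%:R * mdiff h n.+1 x)).
    by rewrite unit_integralD unit_integralZ fo ho mulr0 addr0.
  by move=> x _; rewrite mdiffE_lin; ring.
Qed.

Lemma martingale_sub f h : is_martingale P f -> is_martingale P h ->
  is_martingale P (f - h).
Proof.
move=> fm hm; rewrite (_ : f - h = (-1) *: h + f); first exact: martingale_lin.
by rewrite scaleN1r addrC.
Qed.

Definition of_diffs (d : nat -> R -> R) : nat -> dyadic_line R -> R :=
  fun n x => \sum_(k < n) d k.+1 x.

Lemma mdiff_of_diffs (d : nat -> R -> R) n x : mdiff (of_diffs d) n.+1 x = d n.+1 x.
Proof. by rewrite mdiffS /of_diffs big_ord_recr /= addrAC subrr add0r. Qed.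

Lemma martingale_of_diffs (d : nat -> R -> R) :
  (forall n, level n.+1 (d n.+1)) ->
  (forall n j k, unit_integral P n.+1 j (fun x => (idx n x == k)%:R * d n.+1 x) = 0) ->
  is_martingale P (of_diffs d).
Proof.
move=> dL do_; apply/martingaleP; split.
- by apply/funext => x; rewrite /of_diffs big_ord0.
- move=> n; apply: level_sum => i _; exact: level_le (dL i).
- move=> n j k; rewrite -[RHS](do_ n j k); apply: eq_unit_integral => x _.
  by rewrite mdiff_of_diffs.
Qed.

End Martingales.

(** * Amalgam norms and the pairing *)

Section Suprema.
Variable R : realType.

Lemma poweR_ereal_sup (u : nat -> \bar R) (r : R) : 0 < r ->
  (forall n, 0 <= u n)%E ->
  (ereal_sup (range u) `^ r = ereal_sup (range (fun n => u n `^ r)))%E.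
Proof.
move=> r0 u0.
have s0 : (0 <= ereal_sup (range u))%E.
  by apply: le_trans (u0 0%N) _; apply: ereal_sup_ubound; exists 0%N.
have pos (z : \bar R) : (0 <= z)%E -> z \in `[0%E, +oo%E].
  by move=> z0; rewrite in_itv /= z0 leey.
apply/eqP; rewrite eq_le; apply/andP; split; last first.
  apply: ge_ereal_sup => _ [n _ <-].
  apply: gt0_ler_poweR; rewrite ?pos ?(ltW r0)//.
  by apply: ereal_sup_ubound; exists n.
set S := ereal_sup (range (fun n => u n `^ r)%E).
have S0 : (0 <= S)%E.
  by apply: le_trans (poweR_ge0 (u 0%N) r) _; apply: ereal_sup_ubound; exists 0%N.
have -> : S = ((S `^ r^-1) `^ r)%E.
  by rewrite -poweRrM mulVf ?gt_eqF// poweRe1.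
apply: gt0_ler_poweR; rewrite ?pos ?poweR_ge0 ?(ltW r0)//.
apply: ge_ereal_sup => _ [n _ <-].
have -> : u n = ((u n `^ r) `^ r^-1)%E.
  by rewrite -poweRrM mulfV ?gt_eqF// poweRe1.
apply: gt0_ler_poweR; rewrite ?pos ?poweR_ge0 ?invr_ge0 ?(ltW r0)//.
by apply: ereal_sup_ubound; exists n.
Qed.

(** For nondecreasing sequences suprema are limits, and these commute with finite sums. *)
Lemma sum_ereal_sup (I : Type) (r : seq I) (u : I -> nat -> \bar R) :
  (forall i n, 0 <= u i n)%E -> (forall i, nondecreasing_seq (u i)) ->
  (\sum_(i <- r) ereal_sup (range (u i)) =
   ereal_sup (range (fun n => \sum_(i <- r) u i n)))%E.
Proof.
move=> u0 und.
have c1 := @ereal_nondecreasing_cvgn R (fun n => \sum_(i <- r) u i n)%E.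
have c2 : (fun n => \sum_(i <- r) u i n)%E @ \oo -->
    (\sum_(i <- r) ereal_sup (range (u i)))%E.
  apply: cvg_nnesum => i _; first exact: nearW.
  exact: ereal_nondecreasing_cvgn.
rewrite -(cvg_lim _ c2)//; apply/cvg_lim => //; apply: c1 => n m nm.
by apply: lee_sum => i _; exact: und.
Qed.

End Suprema.

Section AmalgamNorms.
Variables (R : realType) (P : probability (dyadic_line R) R).
Implicit Types (U V : nat -> R -> R) (p q : R).

(** The common features of partial variations and partial maxima, which allow the norms of G and BD
    to be treated together. *)
Definition level_increasing U :=
  [/\ forall n, level n (U n), forall n x, 0 <= U n x &
      forall n x, U n x <= U n.+1 x].

Lemma level_increasing_le U n m x : level_increasing U -> (n <= m)%N ->
  U n x <= U m x.
Proof.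
move=> [_ _ Ui] nm; rewrite -(subnKC nm); elim: (m - n)%N => [|i IH].
  by rewrite addn0.
by rewrite addnS (le_trans IH).
Qed.

Definition unit_moment p U (j : int) n : R := unit_integral P n j (fun x => U n x `^ p).

Lemma unit_moment_ge0 p U j n : 0 <= unit_moment p U j n.
Proof. by apply: unit_integral_ge0 => x; exact: powR_ge0. Qed.

Lemma unit_moment_le p U j n m : 0 <= p -> level_increasing U -> (n <= m)%N ->
  unit_moment p U j n <= unit_moment p U j m.
Proof.
move=> p0 Ui nm; have [UL U0 _] := Ui.
rewrite /unit_moment -(unit_integral_level P j nm);
  last exact: (level_comp (fun a => a `^ p) (UL n)).
by apply: le_unit_integral => x _; apply: ge0_ler_powR => //;
  rewrite ?nnegrE//; exact: level_increasing_le.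
Qed.

(** The q-th power of the amalgam norm cut down to the intervals in [r] and to level n. By
    [amalgam_sum_le_norm] and [amalgam_norm_le] the norm is governed by these finite quantities, and
    all estimates are made on them. *)
Definition amalgam_sum p q U (r : seq int) n : R :=
  \sum_(j <- r) unit_moment p U j n `^ (q / p).

Lemma amalgam_sum_ge0 p q U r n : 0 <= amalgam_sum p q U r n.
Proof. by apply: sumr_ge0 => j _; exact: powR_ge0. Qed.

(** Monotone convergence, once the power has been taken inside the supremum. *)
Lemma integral_sup_moment p U (F : dyadic_line R -> \bar R) j : 0 < p ->
  level_increasing U -> (forall x, F x = ereal_sup (range (fun n => (U n x)%:E))) ->
  (\int[P]_(x in unit_itv R j) (`|F x| `^ p) =
   ereal_sup (range (fun n => (unit_moment p U j n)%:E)))%E.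
Proof.
move=> p0 Ui FE; have [UL U0 Un] := Ui.
have nd x : nondecreasing_seq (fun n => (U n x `^ p)%:E).
  move=> n m nm; rewrite lee_fin; apply: ge0_ler_powR => //; rewrite ?nnegrE ?(ltW p0)//.
  exact: level_increasing_le.
rewrite (eq_integral (fun x : dyadic_line R => limn (fun n => (U n x `^ p)%:E))); last first.
  move=> x _; rewrite FE gee0_abs; last first.
    apply: (@le_trans _ _ (U 0%N x)%:E); first by rewrite lee_fin.
    by apply: ereal_sup_ubound; exists 0%N.
  rewrite poweR_ereal_sup//; last by move=> n; rewrite lee_fin.
  by apply/esym/cvg_lim => //; exact: ereal_nondecreasing_cvgn.
rewrite monotone_convergence; first last.
- by move=> x _; exact: nd.
- by move=> n x _; rewrite lee_fin powR_ge0.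
- move=> n; apply/measurable_EFinP; apply: measurable_level.
  exact: (level_comp (fun a => a `^ p) (UL n)).
- exact: measurable_unit_itv.
have E n : (\int[P]_(x in unit_itv R j) (U n x `^ p)%:E)%E = (unit_moment p U j n)%:E.
  by rewrite (integral_level P j (level_comp (fun a => a `^ p) (UL n))).
under eq_fun do rewrite E.
apply/cvg_lim => //; apply: ereal_nondecreasing_cvgn => n m nm.
by rewrite lee_fin; exact: unit_moment_le (ltW p0) Ui nm.
Qed.

Lemma amalgam_norm_esum p q U (F : dyadic_line R -> \bar R) : 0 < p -> 0 < q ->
  level_increasing U -> (forall x, F x = ereal_sup (range (fun n => (U n x)%:E))) ->
  (amalgam_norm P p q F = (\esum_(j in [set: int])
    ereal_sup (range (fun n => (unit_moment p U j n `^ (q / p))%:E))) `^ q^-1)%E.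
Proof.
move=> p0 q0 Ui FE; congr (_ `^ _)%E; apply: eq_esum => j _.
rewrite (integral_sup_moment _ p0 Ui FE) poweR_ereal_sup ?divr_gt0//.
by move=> n; rewrite lee_fin unit_moment_ge0.
Qed.

Lemma amalgam_sum_le_norm p q U (F : dyadic_line R -> \bar R) r n : 0 < p -> 0 < q ->
  level_increasing U -> (forall x, F x = ereal_sup (range (fun n => (U n x)%:E))) ->
  uniq r -> ((amalgam_sum p q U r n `^ q^-1)%:E <= amalgam_norm P p q F)%E.
Proof.
move=> p0 q0 Ui FE ur; rewrite (amalgam_norm_esum p0 q0 Ui FE) -poweR_EFin.
set E := esum _ _.
have ge0 j : (0 <= ereal_sup (range (fun n => (unit_moment p U j n `^ (q / p))%:E)))%E.
  apply: (@le_trans _ _ (unit_moment p U j 0%N `^ (q / p))%:E).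
    by rewrite lee_fin powR_ge0.
  by apply: ereal_sup_ubound; exists 0%N.
have le : ((amalgam_sum p q U r n)%:E <= E)%E.
  apply: esum_ge; exists [set` r]; first by split=> //; exact: finite_seq.
  rewrite -fsbig_seq// -sumEFin; apply: lee_sum => j _.
  by apply: ereal_sup_ubound; exists n.
apply: gt0_ler_poweR => //; rewrite ?invr_ge0 ?(ltW q0)// in_itv /= leey andbT.
  by rewrite lee_fin amalgam_sum_ge0.
by apply: le_trans le; rewrite lee_fin amalgam_sum_ge0.
Qed.

(** The moments increase with n, so the suprema over n for the finitely many j can be replaced by
    one supremum outside the sum. *)
Lemma amalgam_norm_le p q U (F : dyadic_line R -> \bar R) (C : R) : 0 < p -> 0 < q ->
  level_increasing U -> (forall x, F x = ereal_sup (range (fun n => (U n x)%:E))) ->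
  0 <= C -> (forall r n, uniq r -> amalgam_sum p q U r n <= C `^ q) ->
  (amalgam_norm P p q F <= C%:E)%E.
Proof.
move=> p0 q0 Ui FE C0 H; rewrite (amalgam_norm_esum p0 q0 Ui FE).
set E := esum _ _.
have ge0 j : (0 <= ereal_sup (range (fun n => (unit_moment p U j n `^ (q / p))%:E)))%E.
  apply: (@le_trans _ _ (unit_moment p U j 0%N `^ (q / p))%:E).
    by rewrite lee_fin powR_ge0.
  by apply: ereal_sup_ubound; exists 0%N.
have E0 : (0 <= E)%E by apply: esum_ge0.
have le : (E <= (C `^ q)%:E)%E.
  apply: ge_ereal_sup => _ [X [finX _] <-].
  rewrite fsbig_finite//= sum_ereal_sup.
  - apply: ge_ereal_sup => _ [n _ <-]; rewrite sumEFin lee_fin.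
    by apply: (H (finmap.enum_fset (fset_set X))); exact: finmap.fset_uniq.
  - by move=> j n; rewrite lee_fin powR_ge0.
  - move=> j n m nm; rewrite lee_fin; apply: ge0_ler_powR => //.
    + by rewrite divr_ge0 ?ltW.
    + by rewrite nnegrE unit_moment_ge0.
    + by rewrite nnegrE unit_moment_ge0.
    + exact: unit_moment_le (ltW p0) Ui nm.
rewrite -[leRHS](_ : (C `^ q `^ q^-1)%:E = _); last by rewrite powRK_inv.
rewrite -poweR_EFin; apply: gt0_ler_poweR => //;
  rewrite ?invr_ge0 ?(ltW q0)// in_itv /= leey andbT// lee_fin.
exact: powR_ge0.
Qed.

End AmalgamNorms.

Section Pairing.
Variables (R : realType) (P : probability (dyadic_line R) R).
Implicit Types (f g h : nat -> dyadic_line R -> R) (p q : R).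

Definition variation_upto f (n : nat) (x : R) : R :=
  \sum_(k < n.+1) `|mdiff f k x|.

Definition maxdiff_upto f (n : nat) (x : R) : R :=
  \big[Num.max/0]_(k < n.+1) `|mdiff f k x|.

Lemma variation_increasing f : is_martingale P f ->
  level_increasing (variation_upto f).
Proof.
move=> fm; split.
- move=> n; apply: level_sum => k _; apply: level_comp.
  by apply: level_le (mdiff_level fm); rewrite -ltnS.
- by move=> n x; exact: sumr_ge0.
- by move=> n x; rewrite /variation_upto [leRHS]big_ord_recr lerDl normr_ge0.
Qed.

Lemma maxdiff_increasing f : is_martingale P f ->
  level_increasing (maxdiff_upto f).
Proof.
move=> fm; split.
- move=> n x y xy; apply: eq_bigr => k _; congr `|_|.
  apply: (mdiff_level (n := k) fm); apply: idx_coarser xy.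
  by rewrite -ltnS.
- by move=> n x; exact: bigmax_ge_id.
- move=> n x.
  exact: (@le_bigmax_ord _ R 0 n.+1 n.+2 xpredT (fun k => `|mdiff f k x|)).
Qed.

Lemma le_maxdiff f n k x : (k <= n)%N -> `|mdiff f k x| <= maxdiff_upto f n x.
Proof.
move=> kn; have kn1 : (k < n.+1)%N by rewrite ltnS.
exact: (le_bigmax _ (fun i : 'I_n.+1 => `|mdiff f i x|) (Ordinal kn1)).
Qed.

Lemma variation_sup f x : is_martingale P f ->
  (\sum_(0 <= n <oo) `|mdiff f n x|%:E =
   ereal_sup (range (fun n => (variation_upto f n x)%:E)))%E.
Proof.
move=> fm.
have E : (fun n => (variation_upto f n x)%:E) =
    (fun n => \sum_(0 <= k < n.+1) `|mdiff f k x|%:E)%E.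
  by apply/funext => n; rewrite big_mkord sumEFin.
rewrite E; apply/cvg_lim => //.
rewrite -[X in X --> _]/((fun n => \sum_(0 <= k < n) `|mdiff f k x|%:E)%E @ \oo).
rewrite -cvg_shiftS; apply: ereal_nondecreasing_cvgn => n m nm.
by apply: ereal_nondecreasing_series.
Qed.

Lemma maxdiff_sup f x :
  (ereal_sup (range (fun n => `|mdiff f n x|%:E)) =
   ereal_sup (range (fun n => (maxdiff_upto f n x)%:E)))%E.
Proof.
apply/eqP; rewrite eq_le; apply/andP; split; apply: ge_ereal_sup => _ [n _ <-].
  apply: (@le_trans _ _ (maxdiff_upto f n x)%:E); first by rewrite lee_fin le_maxdiff.
  by apply: ereal_sup_ubound; exists n.
set s := ereal_sup _; rewrite /maxdiff_upto.
have s0 k : (`|mdiff f k x|%:E <= s)%E by apply: ereal_sup_ubound; exists k.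
apply: (big_ind (fun y : R => (y%:E <= s)%E)) => //.
- by apply: le_trans (s0 0%N); rewrite lee_fin.
- by move=> a b ha hb; rewrite /Num.max; case: ifP.
Qed.

Lemma G_norm_ge f p q r n : 0 < p -> 0 < q -> is_martingale P f -> uniq r ->
  ((amalgam_sum P p q (variation_upto f) r n `^ q^-1)%:E <= G_norm P p q f)%E.
Proof.
move=> p0 q0 fm ur; apply: amalgam_sum_le_norm => //.
  exact: variation_increasing.
by move=> x; exact: variation_sup.
Qed.

Lemma G_norm_le f p q C : 0 < p -> 0 < q -> is_martingale P f -> 0 <= C ->
  (forall r n, uniq r -> amalgam_sum P p q (variation_upto f) r n <= C `^ q) ->
  (G_norm P p q f <= C%:E)%E.
Proof.
move=> p0 q0 fm C0 H; apply: (@amalgam_norm_le _ _ _ _ (variation_upto f)) => //.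
  exact: variation_increasing.
by move=> x; exact: variation_sup.
Qed.

Lemma BD_norm_ge f p q r n : 0 < p -> 0 < q -> is_martingale P f -> uniq r ->
  ((amalgam_sum P p q (maxdiff_upto f) r n `^ q^-1)%:E <= BD_norm P p q f)%E.
Proof.
move=> p0 q0 fm ur; apply: amalgam_sum_le_norm => //.
  exact: maxdiff_increasing.
by move=> x; exact: maxdiff_sup.
Qed.

Lemma BD_norm_le f p q C : 0 < p -> 0 < q -> is_martingale P f -> 0 <= C ->
  (forall r n, uniq r -> amalgam_sum P p q (maxdiff_upto f) r n <= C `^ q) ->
  (BD_norm P p q f <= C%:E)%E.
Proof.
move=> p0 q0 fm C0 H; apply: (@amalgam_norm_le _ _ _ _ (maxdiff_upto f)) => //.
  exact: maxdiff_increasing.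
by move=> x; exact: maxdiff_sup.
Qed.

Lemma G_norm_ge0 f p q : (0 <= G_norm P p q f)%E.
Proof. exact: poweR_ge0. Qed.

Lemma BD_norm_ge0 f p q : (0 <= BD_norm P p q f)%E.
Proof. exact: poweR_ge0. Qed.

Lemma hoelder_unit_integral n j (u v : R -> R) p q :
  (forall x, 0 <= u x) -> (forall x, 0 <= v x) ->
  0 < p -> 0 < q -> p^-1 + q^-1 = 1 ->
  unit_integral P n j (fun x => u x * v x) <=
  unit_integral P n j (fun x => u x `^ p) `^ p^-1 * unit_integral P n j (fun x => v x `^ q) `^ q^-1.
Proof.
move=> u0 v0 p0 q0 pq.
have w0 := @atom_mass_ge0 R P n j.
have := @hoelder_sum R _ (index_enum 'I_(2 ^ n))
  (fun i => atom_mass P j i `^ p^-1 * u (atom_pt R j i))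
  (fun i => atom_mass P j i `^ q^-1 * v (atom_pt R j i)) p q _ _ p0 q0 pq.
have E1 : \sum_(i < 2 ^ n) (atom_mass P j i `^ p^-1 * u (atom_pt R j i)) `^ p =
    unit_integral P n j (fun x => u x `^ p).
  by apply: eq_bigr => i _; rewrite powRM ?powR_ge0// powR_invK.
have E2 : \sum_(i < 2 ^ n) (atom_mass P j i `^ q^-1 * v (atom_pt R j i)) `^ q =
    unit_integral P n j (fun x => v x `^ q).
  by apply: eq_bigr => i _; rewrite powRM ?powR_ge0// powR_invK.
rewrite E1 E2 => H; apply: le_trans (H _ _).
- apply: ler_sum => i _; rewrite mulrACA -powRD; last by rewrite pq oner_eq0.
  by rewrite pq powRr1.
- by move=> i; rewrite mulr_ge0 ?powR_ge0.
- by move=> i; rewrite mulr_ge0 ?powR_ge0.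
Qed.

Section Conjugate.
Variables (p q p' q' : R).
Hypotheses (hp : 1 < p) (hq : 1 < q).
Hypotheses (hp' : p^-1 + p'^-1 = 1) (hq' : q^-1 + q'^-1 = 1).

Let p0 : 0 < p. Proof. by rewrite (lt_trans _ hp). Qed.
Let q0 : 0 < q. Proof. by rewrite (lt_trans _ hq). Qed.
Let p'0 : 0 < p'. Proof. by have [] := conjugate_exponentE hp hp'. Qed.
Let q'0 : 0 < q'. Proof. by have [] := conjugate_exponentE hq hq'. Qed.

Lemma hoelder_amalgam_sum U V r n : level_increasing U -> level_increasing V ->
  \sum_(j <- r) unit_integral P n j (fun x => U n x * V n x) <=
  amalgam_sum P p q U r n `^ q^-1 * amalgam_sum P p' q' V r n `^ q'^-1.
Proof.
move=> [_ U0 _] [_ V0 _].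
apply: (@le_trans _ _ (\sum_(j <- r) unit_moment P p U j n `^ p^-1 *
    unit_moment P p' V j n `^ p'^-1)).
  by apply: ler_sum => j _; exact: hoelder_unit_integral.
apply: le_trans (hoelder_sum _ _ _ q0 q'0 hq') _.
- by move=> j; exact: powR_ge0.
- by move=> j; exact: powR_ge0.
have E (s t a : R) : (a `^ s^-1) `^ t = a `^ (t / s) by rewrite -powRrM mulrC.
have S s t W : \sum_(j <- r) (unit_moment P s W j n `^ s^-1) `^ t =
    amalgam_sum P s t W r n by apply: eq_bigr => j _; rewrite E.
have cong (a b a' b' : R) : a = a' -> b = b' ->
  a `^ q^-1 * b `^ q'^-1 <= a' `^ q^-1 * b' `^ q'^-1 by move=> -> ->.
exact: cong (S p q U) (S p' q' V).
Qed.

Lemma integral_pairing_le f g n : is_martingale P f -> is_martingale P g ->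
  (\int[P]_x (variation_upto f n x * maxdiff_upto g n x)%:E <=
   G_norm P p q f * BD_norm P p' q' g)%E.
Proof.
move=> fm gm; have Ui := variation_increasing fm; have Vi := maxdiff_increasing gm.
have [UL U0 _] := Ui; have [VL V0 _] := Vi.
have UVL := level_comp2 (fun a b => a * b) (UL n) (VL n).
rewrite integral_unit_itvs; first last.
- by move=> x; rewrite lee_fin mulr_ge0.
- by apply/measurable_EFinP; exact: measurable_level UVL.
apply: ge_ereal_sup => _ [X [finX _] <-]; rewrite fsbig_finite//=.
under eq_bigr do rewrite (integral_level P _ UVL).
rewrite sumEFin; set r := finmap.enum_fset _.
have ur : uniq r by exact: finmap.fset_uniq.
apply: (@le_trans _ _ (amalgam_sum P p q (variation_upto f) r n `^ q^-1 *
  amalgam_sum P p' q' (maxdiff_upto g) r n `^ q'^-1)%:E).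
  by rewrite lee_fin; exact: hoelder_amalgam_sum.
rewrite EFinM; apply: lee_pmul; rewrite ?lee_fin ?powR_ge0//.
- exact: G_norm_ge ur.
- exact: BD_norm_ge ur.
Qed.

End Conjugate.
End Pairing.

(** * Convergence of the pairing and the upper bound *)

Section Kappa.
Variables (R : realType) (P : probability (dyadic_line R) R).
Implicit Types (f g h : nat -> dyadic_line R -> R).
Variables (p q p' q' : R).
Hypotheses (hp : 1 < p) (hq : 1 < q).
Hypotheses (hp' : p^-1 + p'^-1 = 1) (hq' : q^-1 + q'^-1 = 1).

Lemma level_kappa_term f g k : is_martingale P f -> is_martingale P g ->
  level k (kappa_term g f k).
Proof.
by move=> fm gm; exact: (level_comp2 (fun a b => a * b)
  (mdiff_level (n := k) fm) (mdiff_level (n := k) gm)).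
Qed.

Lemma sum_kappa_term_le f g n x :
  \sum_(k < n.+1) `|kappa_term g f k x| <= variation_upto f n x * maxdiff_upto g n x.
Proof.
rewrite /variation_upto mulr_suml; apply: ler_sum => k _.
rewrite normrM; apply: ler_wpM2l; first exact: normr_ge0.
by apply: le_maxdiff; rewrite -ltnS.
Qed.

(** The bound is uniform in n. It yields at once the integrability of each term, the absolute
    convergence of the series and the estimate of its sum. *)
Lemma integral_kappa_terms_le f g n : is_martingale P f -> is_martingale P g ->
  (\sum_(k < n.+1) \int[P]_x `|kappa_term g f k x|%:E <=
   G_norm P p q f * BD_norm P p' q' g)%E.
Proof.
move=> fm gm.
have mk k : measurable_fun [set: dyadic_line R] (fun x => `|kappa_term g f k x|%:E).
  apply/measurable_EFinP; apply: measurable_level.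
  exact: (level_comp (fun a => `|a|) (level_kappa_term (k := k) fm gm)).
have [UL U0 _] := variation_increasing fm; have [VL V0 _] := maxdiff_increasing gm.
rewrite -ge0_integral_sum//.
apply: le_trans (integral_pairing_le hp hq hp' hq' n fm gm).
apply: ge0_le_integral => //.
- by move=> x _; apply: sume_ge0 => k _; rewrite lee_fin.
- by apply: emeasurable_sum => k.
- apply/measurable_EFinP; apply: measurable_level.
  exact: (level_comp2 (fun a b => a * b) (UL n) (VL n)).
- by move=> x _; rewrite sumEFin lee_fin; exact: sum_kappa_term_le.
Qed.

Section Bounded.
Variables f g : nat -> dyadic_line R -> R.
Hypotheses (fm : is_martingale P f) (gm : is_martingale P g).
Hypotheses (fG : (G_norm P p q f < +oo)%E) (gBD : (BD_norm P p' q' g < +oo)%E).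

Let a k := fine 'E_P[kappa_term g f k].
Let b k := fine (\int[P]_x `|kappa_term g f k x|%:E)%E.
Let M := fine (G_norm P p q f) * fine (BD_norm P p' q' g).

Let fG_fin : G_norm P p q f \is a fin_num.
Proof. by rewrite ge0_fin_numE// G_norm_ge0. Qed.

Let gBD_fin : BD_norm P p' q' g \is a fin_num.
Proof. by rewrite ge0_fin_numE// BD_norm_ge0. Qed.

Let ME : (G_norm P p q f * BD_norm P p' q' g = M%:E)%E.
Proof. by rewrite EFinM !fineK. Qed.

Lemma kappa_term_integrable k : P.-integrable setT (EFin \o kappa_term g f k).
Proof.
apply/integrableP; split.
  by apply/measurable_EFinP; apply: measurable_level; exact: (level_kappa_term (k := k)).
apply: (@le_lt_trans _ _ M%:E); last exact: ltry.
rewrite -ME; apply: le_trans (integral_kappa_terms_le k fm gm).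
rewrite big_ord_recr /= leeDr//; apply: sume_ge0 => i _.
by apply: integral_ge0 => x _; rewrite lee_fin.
Qed.

Let b0 k : 0 <= b k.
Proof. by rewrite fine_ge0// integral_ge0// => x _; rewrite lee_fin. Qed.

Let bE k : (\int[P]_x `|kappa_term g f k x|%:E = (b k)%:E)%E.
Proof.
rewrite fineK// ge0_fin_numE; last by rewrite integral_ge0// => x _; rewrite lee_fin.
by have /integrableP[] := kappa_term_integrable k.
Qed.

Let sumb n : \sum_(0 <= k < n) b k <= M.
Proof.
apply: (@le_trans _ _ (\sum_(0 <= k < n.+1) b k)).
  by rewrite big_nat_recr//= lerDl.
rewrite -lee_fin -ME big_mkord -sumEFin.
under eq_bigr do rewrite -bE.
exact: integral_kappa_terms_le.
Qed.

Let ab k : `|a k| <= b k.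
Proof.
have ik := kappa_term_integrable k.
rewrite -lee_fin -bE -abse_EFin /a fineK; last by rewrite unlock; exact: integrable_fin_num.
rewrite unlock; apply: le_abse_integral => //.
by have /integrableP[] := ik.
Qed.

Let a0 : a 0%N = 0.
Proof.
rewrite /a unlock (eq_integral (cst 0%E)) ?integral_cst ?mul0e//.
by move=> x _; rewrite /kappa_term !mdiff0 /= mul0r.
Qed.

(** [kappa] sums from 1 and [series] from 0; the additional term is 0 because d_0 f = 0. *)
Let sumE n : \sum_(1 <= k < n) a k = series a n.
Proof.
rewrite /series /=; case: n => [|n]; first by rewrite !big_geq.
by rewrite [RHS]big_ltn// a0 add0r.
Qed.

Lemma kappa_cvg : cvgn (fun n : nat => \sum_(1 <= k < n) fine 'E_P[kappa_term g f k]).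
Proof.
rewrite (_ : (fun n => _) = series a); last by apply/funext => n; exact: sumE.
apply: (@normed_cvg R R^o a); apply: nondecreasing_is_cvgn.
  by apply: nondecreasing_series => *; exact: normr_ge0.
exists M => _ [n _ <-]; apply: le_trans (sumb n).
by apply: ler_sum => k _; exact: ab.
Qed.

Lemma kappa_le : `|kappa P g f| <= fine (G_norm P p q f) * fine (BD_norm P p' q' g).
Proof.
have s n : `|\sum_(1 <= k < n) a k| <= M.
  rewrite sumE; apply: le_trans (ler_norm_sum _ _ _) (le_trans _ (sumb n)).
  by apply: ler_sum => k _; exact: ab.
rewrite ler_norml; apply/andP; split.
  apply: limr_ge; first exact: kappa_cvg.
  by apply: nearW => n; have := s n; rewrite ler_norml => /andP[].
apply: limr_le; first exact: kappa_cvg.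
by apply: nearW => n; have := s n; rewrite ler_norml => /andP[].
Qed.

End Bounded.

End Kappa.

(** Three independent pairs of processes are allowed, so that linearity in f and linearity in g are
    both instances. *)
Lemma kappa_linear_combination (R : realType) (P : probability (dyadic_line R) R)
    (a : R) (f f1 f2 g g1 g2 : nat -> dyadic_line R -> R) :
  (forall k x, kappa_term g f k x = a * kappa_term g1 f1 k x + kappa_term g2 f2 k x) ->
  (forall k, P.-integrable setT (EFin \o kappa_term g1 f1 k)) ->
  (forall k, P.-integrable setT (EFin \o kappa_term g2 f2 k)) ->
  cvgn (fun n : nat => \sum_(1 <= k < n) fine 'E_P[kappa_term g1 f1 k]) ->
  cvgn (fun n : nat => \sum_(1 <= k < n) fine 'E_P[kappa_term g2 f2 k]) ->
  kappa P g f = a * kappa P g1 f1 + kappa P g2 f2.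
Proof.
move=> E i1 i2 c1 c2.
have EE k : fine 'E_P[kappa_term g f k] =
    a * fine 'E_P[kappa_term g1 f1 k] + fine 'E_P[kappa_term g2 f2 k].
  rewrite unlock (eq_integral (fun x => a%:E * (kappa_term g1 f1 k x)%:E +
      (kappa_term g2 f2 k x)%:E)%E); last by move=> x _; rewrite E.
  have ia : P.-integrable setT (fun x => a%:E * (kappa_term g1 f1 k x)%:E)%E.
    by apply: integrableZl => //; exact: i1.
  rewrite (integralD measurableT ia (i2 k)).
  rewrite (integralZl _ (i1 k))// fineD.
  - by rewrite fineM// integrable_fin_num//; exact: i1.
  - by rewrite fin_numM// integrable_fin_num//; exact: i1.
  - by rewrite integrable_fin_num//; exact: i2.
have -> : (kappa P g f) = limn (fun n : nat =>
    a * (\sum_(1 <= k < n) fine 'E_P[kappa_term g1 f1 k]) +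
    \sum_(1 <= k < n) fine 'E_P[kappa_term g2 f2 k]).
  congr (limn _); apply/funext => n.
  by rewrite mulr_sumr -big_split; apply: eq_bigr => k _; exact: EE.
apply/cvg_lim => //; apply: cvgD => //.
by apply: cvgM => //; exact: cvg_cst.
Qed.

Lemma near_supremum (R : realType) (T : Type) (Q : T -> Prop) (u : T -> R) (B e : R) :
  (exists t, Q t) -> (forall t, Q t -> u t <= B) -> 0 < e ->
  exists2 t, Q t & forall s, Q s -> u s <= u t + e.
Proof.
move=> [t0 Qt0] uB e0; pose S := [set u t | t in [set t | Q t]].
have hS : has_sup S.
  by split; [exists (u t0), t0 | exists B => _ [t /= Qt <-]; exact: uB].
have [_ [t /= Qt <-] lt] := sup_adherent e0 hS.
exists t => // s Qs; apply: (@le_trans _ _ (sup S)).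
  by apply: sup_upper_bound => //; exists s.
by rewrite -lerBlDr ltW.
Qed.

Lemma ler_sum_uniq (R : realType) (I : eqType) (F : I -> R) (r r' : seq I) :
  uniq r -> uniq r' -> (forall j, 0 <= F j) -> (forall j, j \notin r -> F j = 0) ->
  \sum_(j <- r') F j <= \sum_(j <- r) F j.
Proof.
move=> ur ur' F0 Fr.
rewrite (bigID (fun j => j \in r)) /= [X in _ + X]big1 => [|j /Fr //].
rewrite addr0 [leRHS](bigID (fun j => j \in r')) /=.
rewrite -big_filter -[X in _ <= X + _]big_filter.
rewrite (perm_big [seq j <- r | j \in r']).
  by rewrite lerDl sumr_ge0.
apply: uniq_perm; rewrite ?filter_uniq// => j.
by rewrite !mem_filter andbC.
Qed.

(** * Density of finite martingales *)

Section FiniteMartingales.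
Variables (R : realType) (P : probability (dyadic_line R) R).
Implicit Types (f g h : nat -> dyadic_line R -> R) (r : seq int) (p q : R).

Definition finite_martingale (N : nat) r f :=
  [/\ is_martingale P f, forall n x, (N < n)%N -> mdiff f n x = 0 &
      forall n x, idx 0 x \notin r -> mdiff f n x = 0].

Lemma finite_variation N r f n x : finite_martingale N r f -> (N <= n)%N ->
  variation_upto f n x = variation_upto f N x.
Proof.
move=> [_ fN _] Nn; rewrite /variation_upto -(big_mkord xpredT (fun k => `|mdiff f k x|)).
rewrite (big_cat_nat (n := N.+1))//= [X in _ + X]big_nat_cond [X in _ + X]big1.
  by rewrite addr0 big_mkord.
by move=> k; rewrite andbT => /andP[/fN -> _]; rewrite normr0.
Qed.

(** The variation stops growing at level N and vanishes off the intervals of [r], so the supremum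
    that defines the norm is attained at (r, N). *)
Lemma finite_amalgam_sum_le N r f p q r' n : 0 < p -> 0 < q ->
  finite_martingale N r f -> uniq r -> uniq r' ->
  amalgam_sum P p q (variation_upto f) r' n <= amalgam_sum P p q (variation_upto f) r N.
Proof.
move=> p0 q0 ff ur ur'; have [fm fN fr] := ff.
have Vi := variation_increasing fm; have [VL V0 _] := Vi.
have qp0 : 0 < q / p by rewrite divr_gt0.
apply: (@le_trans _ _ (amalgam_sum P p q (variation_upto f) r' N)).
  apply: ler_sum => j _; apply: ge0_ler_powR; rewrite ?nnegrE ?unit_moment_ge0 ?(ltW qp0)//.
  apply: (@le_trans _ _ (unit_moment P p (variation_upto f) j (maxn n N))).
    by apply: unit_moment_le; rewrite ?leq_maxl ?(ltW p0).
  rewrite /unit_moment (@eq_unit_integral _ _ _ _ _ (fun x => variation_upto f N x `^ p)).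
    by rewrite (unit_integral_level P j (leq_maxr n N) (level_comp (fun a => a `^ p) (VL N))).
  by move=> x _; rewrite (finite_variation x ff (leq_maxr n N)).
apply: ler_sum_uniq => // j; first exact: powR_ge0.
move=> jr; rewrite /unit_moment (@eq_unit_integral _ _ _ _ _ (fun=> 0)); last first.
  move=> x xj; rewrite /variation_upto big1 ?powR0 ?gt_eqF// => k _.
  by rewrite fr ?normr0// xj.
by rewrite unit_integral0 powR0// gt_eqF.
Qed.

Lemma finite_G_norm_le N r f p q : 0 < p -> 0 < q ->
  finite_martingale N r f -> uniq r ->
  (G_norm P p q f <= (amalgam_sum P p q (variation_upto f) r N `^ q^-1)%:E)%E.
Proof.
move=> p0 q0 ff ur; have [fm _ _] := ff.
apply: G_norm_le => //; first exact: powR_ge0.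
move=> r' n ur'; rewrite (powR_invK q0 (amalgam_sum_ge0 _ _ _ _ _ _)).
exact: finite_amalgam_sum_le.
Qed.

Lemma finite_G_space N r f p q : 0 < p -> 0 < q ->
  finite_martingale N r f -> uniq r -> G_space P p q f.
Proof.
move=> p0 q0 ff ur; split; first by case: ff.
exact: le_lt_trans (finite_G_norm_le p0 q0 ff ur) (ltry _).
Qed.

Lemma finite_martingale_lin N r a f h :
  finite_martingale N r f -> finite_martingale N r h ->
  finite_martingale N r (a *: f + h).
Proof.
move=> [fm fN fr] [hm hN hr]; split; first exact: martingale_lin.
- by move=> n x Nn; rewrite mdiffE_lin fN ?hN// mulr0 addr0.
- by move=> n x xr; rewrite mdiffE_lin fr ?hr// mulr0 addr0.
Qed.

Lemma expectation_level n r (X : R -> R) : level n X -> uniq r ->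
  (forall x, idx 0 x \notin r -> X x = 0) ->
  ('E_P[X : dyadic_line R -> R] = (\sum_(j <- r) unit_integral P n j X)%:E)%E.
Proof.
move=> LX ur Xr; rewrite unlock.
pose D := \big[setU/set0]_(j <- r) unit_itv R j.
have -> : (\int[P]_x (X x)%:E = \int[P]_(x in D) (X x)%:E)%E.
  rewrite [RHS]integral_mkcond; apply: eq_integral => x _; rewrite /patch.
  case: ifPn => //; rewrite notin_setE => nD; rewrite Xr//; apply/negP => xr.
  by apply: nD; rewrite /D -bigcup_seq; exists (idx 0 x) => //; rewrite unit_itvE.
rewrite integral_bigsetU_EFin//.
- by rewrite -sumEFin; apply: eq_bigr => j _; rewrite (integral_level P j LX).
- by move=> j; exact: measurable_unit_itv.
- by move=> i j _ _ [x []]; rewrite !unit_itvE => <- <-.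
- by apply/measurable_EFinP; exact: measurable_level LX.
Qed.

Lemma finite_kappa N r f g : finite_martingale N r f -> is_martingale P g -> uniq r ->
  kappa P g f = \sum_(n < N) \sum_(j <- r)
    unit_integral P N j (fun x => mdiff f n.+1 x * mdiff g n.+1 x).
Proof.
move=> [fm fN fr] gm ur.
have E k : ('E_P[kappa_term g f k] =
    (\sum_(j <- r) unit_integral P k j (kappa_term g f k))%:E)%E.
  apply: expectation_level => //; first exact: level_kappa_term fm gm.
  by move=> x xr; rewrite /kappa_term fr// mul0r.
have Z k : (N < k)%N -> fine 'E_P[kappa_term g f k] = 0.
  move=> Nk; rewrite E /= big1// => j _.
  rewrite (@eq_unit_integral _ _ _ _ _ (fun=> 0)) ?unit_integral0//.
  by move=> x _; rewrite /kappa_term fN// mul0r.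
have -> : kappa P g f = \sum_(1 <= k < N.+1) fine 'E_P[kappa_term g f k].
  apply: lim_near_cst => //; exists N.+1 => // n /= Nn.
  rewrite (big_cat_nat (n := N.+1))//= [X in _ + X]big_nat_cond [X in _ + X]big1 ?addr0//.
  by move=> k; rewrite andbT => /andP[/Z].
rewrite big_add1 big_mkord; apply: eq_bigr => k _; rewrite E /=.
apply: eq_bigr => j _.
by rewrite -(unit_integral_level P j (ltn_ord k) (level_kappa_term (k := k.+1) fm gm)).
Qed.

(** Cutting down to whole intervals [j, j+1) preserves martingales: their indicators have level 0
    and can be absorbed into the test function for orthogonality. *)
Definition truncate (N : nat) r f : nat -> dyadic_line R -> R :=
  of_diffs (fun n x => if (n <= N)%N && (idx 0 x \in r) then mdiff f n x else 0).

Lemma mdiff_truncate N r f n x : mdiff (truncate N r f) n x =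
  if (n <= N)%N && (idx 0 x \in r) then mdiff f n x else 0.
Proof.
by case: n => [|n]; [rewrite !mdiff0; case: ifP | rewrite mdiff_of_diffs].
Qed.

Lemma finite_truncate N r f : is_martingale P f -> finite_martingale N r (truncate N r f).
Proof.
move=> fm.
have LD n : level n (fun x : R => if (n <= N)%N && (idx 0 x \in r) then mdiff f n x else 0).
  move=> x y xy; rewrite (idx_coarser (leq0n n) xy).
  by rewrite (mdiff_level (n := n) fm xy).
split.
- apply: martingale_of_diffs => [n|n j k]; first exact: LD.
  rewrite (@eq_unit_integral _ _ _ _ _ (fun x =>
    ((idx n x == k)%:R * ((n < N)%N && (idx 0 x \in r))%:R) * mdiff f n.+1 x)).
    apply: (@mdiff_orthogonal _ _ _ _ _ _ (fun x =>
      (idx n x == k)%:R * ((n < N)%N && (idx 0 x \in r))%:R)) => //.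
    by move=> x y xy; rewrite xy (idx_coarser (leq0n n) xy).
  by move=> x _; case: ifP => _; rewrite ?mulr1 // !mulr0 mul0r.
- by move=> n x Nn; rewrite mdiff_truncate leqNgt Nn.
- by move=> n x xr; rewrite mdiff_truncate (negbTE xr) andbF.
Qed.

Lemma variation_truncate N r f n x : (N <= n)%N ->
  variation_upto (truncate N r f - f) n x =
  if idx 0 x \in r then variation_upto f n x - variation_upto f N x
  else variation_upto f n x.
Proof.
move=> Nn; rewrite /variation_upto; case: ifPn => xr.
  rewrite -2!(big_mkord xpredT (fun k => `|mdiff _ k x|)).
  rewrite -(big_mkord xpredT (fun k => `|mdiff f k x|)).
  rewrite (big_cat_nat (n := N.+1))//= [X in X + _]big_nat_cond [X in X + _]big1.
    rewrite add0r [X in _ = X - _](big_cat_nat (n := N.+1))//= addrAC subrr add0r.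
    apply: eq_big_nat => k /andP[Nk _].
    by rewrite mdiffE_sub mdiff_truncate leqNgt Nk /= sub0r normrN.
  move=> k; rewrite andbT ltnS => /andP[_ kN].
  by rewrite mdiffE_sub mdiff_truncate kN xr /= subrr normr0.
apply: eq_bigr => k _.
by rewrite mdiffE_sub mdiff_truncate (negbTE xr) andbF sub0r normrN.
Qed.

(* First the finitely many intervals [j \in r] are chosen so that the others
   contribute little, then [N] so that on these [variation_upto f N] is close
   to the total variation; there [a^p + b^p <= (a + b)^p] controls the tail. *)
Lemma finite_martingale_dense p q f (d : R) : 1 < p -> 0 < q -> 0 < d ->
  G_space P p q f ->
  exists N r h, [/\ uniq r, finite_martingale N r h & (G_norm P p q (h - f)%R < d%:E)%E].
Proof.
move=> p1 q0 d0 [fm fG]; have p0 : 0 < p by rewrite (lt_trans _ p1).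
have t0 : 0 < q / p by rewrite divr_gt0.
have Vi := variation_increasing fm; have [VL V0 _] := Vi.
set V := variation_upto f.
pose B := fine (G_norm P p q f) `^ q.
have sB r n : uniq r -> amalgam_sum P p q V r n <= B.
  move=> ur; have := G_norm_ge n p0 q0 fm ur.
  rewrite -[G_norm P p q f]fineK ?ge0_fin_numE ?G_norm_ge0// lee_fin => H.
  rewrite -[leLHS](powR_invK q0 (amalgam_sum_ge0 P p q V r n)).
  apply: ge0_ler_powR H; rewrite ?nnegrE ?(ltW q0) ?powR_ge0//.
  by rewrite fine_ge0// G_norm_ge0.
(* Half of the budget (d/2)^q is spent on the intervals in [r], half on the others. *)
pose e := (d / 2) `^ q / 2.
have e0 : 0 < e by rewrite divr_gt0// powR_gt0// divr_gt0.
(* A nearly maximal pair (r, n0): adding intervals or levels gains at most [e]. *)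
have [[r n0] /= ur rmax] := @near_supremum R (seq int * nat) (fun rn => uniq rn.1)
  (fun rn => amalgam_sum P p q V rn.1 rn.2) B e
  (ex_intro _ ([::], 0%N) isT) (fun rn => sB rn.1 rn.2) e0.
(* Chosen so that a moment of at most [eta] contributes at most e / (size r + 1) to the amalgam sum;
   the successor avoids division by 0 for empty [r]. *)
pose eta := (e / (size r).+1%:R) `^ (q / p)^-1.
have eta0 : 0 < eta by rewrite powR_gt0// divr_gt0.
have uB j n : unit_moment P p V j n <= B `^ (q / p)^-1.
  rewrite -[leLHS](powRK_inv t0 (unit_moment_ge0 P p V j n)).
  apply: ge0_ler_powR; rewrite ?nnegrE ?powR_ge0 ?invr_ge0 ?(ltW t0)//.
  by have := sB [:: j] n isT; rewrite /amalgam_sum big_seq1.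
have [N n0N NP] : exists2 N, (n0 <= N)%N &
    forall j, j \in r -> forall n, unit_moment P p V j n <= unit_moment P p V j N + eta.
  elim: (r) => [|j s [N n0N IH]]; first by exists n0.
  have [N' _ HN'] := @near_supremum R nat (fun=> True) (unit_moment P p V j)
    _ eta (ex_intro _ 0%N I) (fun n _ => uB j n) eta0.
  exists (maxn N N'); first by rewrite (leq_trans n0N)// leq_maxl.
  move=> i; rewrite inE => /predU1P[->|si] n.
    apply: (le_trans (HN' n I)); rewrite lerD2r.
    by apply: unit_moment_le; rewrite ?(ltW p0) ?leq_maxr.
  apply: (le_trans (IH i si n)); rewrite lerD2r.
  by apply: unit_moment_le; rewrite ?(ltW p0) ?leq_maxl.
have hf := finite_truncate N r fm.
exists N, r, (truncate N r f); split => //.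
have hm : is_martingale P (truncate N r f - f) by apply: martingale_sub => //; case: hf.
have Wi := variation_increasing hm; have [WL W0 _] := Wi.
apply: (@le_lt_trans _ _ (d / 2)%:E); last by rewrite lte_fin ltr_pdivrMr// ltr_pMr// ltr1n.
apply: G_norm_le => //; first by rewrite divr_ge0// ltW.
move=> r' n' ur'.
set W := variation_upto _ in Wi WL W0 *.
pose n := maxn n' N.
have Nn : (N <= n)%N by rewrite leq_maxr.
apply: (@le_trans _ _ (amalgam_sum P p q W r' n)).
  apply: ler_sum => j _; apply: ge0_ler_powR; rewrite ?nnegrE ?unit_moment_ge0 ?(ltW t0)//.
  by apply: unit_moment_le; rewrite ?(ltW p0) ?leq_maxl.
rewrite /amalgam_sum (bigID (fun j => j \in r)) /=.
have -> : (d / 2) `^ q = e + e by rewrite /e [LHS]splitr.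
apply: lerD.
  apply: (@le_trans _ _ (\sum_(j <- r') if j \in r then e / (size r).+1%:R else 0)).
    rewrite [leRHS](bigID (fun j => j \in r)) /= [X in _ + X]big1 ?addr0; last first.
      by move=> j /negbTE ->.
    apply: ler_sum => j jr; rewrite jr.
    have -> : e / (size r).+1%:R = eta `^ (q / p).
      by rewrite powR_invK// divr_ge0// ltW.
    apply: ge0_ler_powR; rewrite ?nnegrE ?unit_moment_ge0 ?(ltW t0) ?(ltW eta0)//.
    have : unit_moment P p W j n + unit_moment P p V j N <= unit_moment P p V j n.
      rewrite /unit_moment -(unit_integral_level P j Nn (level_comp (fun a => a `^ p) (VL N))).
      rewrite -unit_integralD.
      apply: le_unit_integral => x xj; rewrite /W variation_truncate// xj jr.
      have VN : V N x <= V n x by exact: level_increasing_le.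
      have := @powRD_superadditive R p (V n x - V N x) (V N x) p1.
      by rewrite subrK; apply; rewrite ?subr_ge0// V0.
    have := NP j jr n; lra.
  apply: (@le_trans _ _ (\sum_(j <- r) if j \in r then e / (size r).+1%:R else 0)).
    apply: ler_sum_uniq => // j; last by move=> /negbTE ->.
    by case: ifP => // _; rewrite divr_ge0// ltW.
  rewrite big_seq (eq_bigr (fun=> e / (size r).+1%:R)) => [|j ->//].
  rewrite -big_seq big_const_seq count_predT iter_addr_0 -[leLHS]mulr_natl.
  rewrite mulrCA ler_piMr ?(ltW e0)// ler_pdivrMr// mul1r ler_nat.
  by rewrite leqnSn.
rewrite (eq_bigr (fun j => unit_moment P p V j n `^ (q / p))); last first.
  move=> j jr; congr (_ `^ _); apply: eq_unit_integral => x xj.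
  by rewrite /W variation_truncate// xj (negbTE jr).
(* Near maximality is applied to [r] enlarged by the new intervals of [r'], whose total contribution
   is therefore at most [e]. *)
have ur2 : uniq (r ++ [seq j <- r' | j \notin r]).
  rewrite cat_uniq ur filter_uniq// andbT /=; apply/hasPn => j.
  by rewrite mem_filter => /andP[].
have := rmax (_, n) ur2; rewrite /= /amalgam_sum big_cat /= big_filter.
have : amalgam_sum P p q V r n0 <= amalgam_sum P p q V r n.
  apply: ler_sum => j _; apply: ge0_ler_powR; rewrite ?nnegrE ?unit_moment_ge0 ?(ltW t0)//.
  by apply: unit_moment_le; rewrite ?(ltW p0)// (leq_trans n0N).
rewrite /amalgam_sum; lra.
Qed.

End FiniteMartingales.

(** * The lower bound for the norm of [kappa P g] *)

Local Arguments mdiff : simpl never.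

Section TestMartingale.
Variables (R : realType) (P : probability (dyadic_line R) R).
Implicit Types (f g : nat -> dyadic_line R -> R) (r : seq int) (v w : nat -> R -> R).

(** No level condition is put on [v n], since [cond_mean P N] reads it only at the left endpoints of
    intervals of level N. The cut at n <= N is essential: beyond N the formula for [cond_mean] is no
    longer a conditional expectation. *)
Definition projected_diff (N : nat) r v (n : nat) (x : R) : R :=
  if (n <= N)%N && (idx 0 x \in r)
  then cond_mean P N n (v n) x - cond_mean P N n.-1 (v n) x else 0.

Definition test_martingale N r v := of_diffs (projected_diff N r v).

Lemma mdiff_test N r v n x :
  mdiff (test_martingale N r v) n.+1 x = projected_diff N r v n.+1 x.
Proof. exact: mdiff_of_diffs. Qed.

Lemma unit_integral_mul_cond_mean N n j (u v : R -> R) : level n u ->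
  unit_integral P N j (fun x => u x * cond_mean P N n v x) =
  unit_integral P N j (fun x => u x * v x).
Proof. by move=> Lu; rewrite unit_integral_cond_mean_selfadjoint unit_integral_cond_mean_level. Qed.

Lemma level_projected_diff N r v n : level n.+1 (projected_diff N r v n.+1).
Proof.
move=> x y xy; rewrite /projected_diff (idx_coarser (leq0n _) xy).
rewrite (level_cond_mean P N (v n.+1) xy) /=.
by rewrite (level_cond_mean P N (v n.+1) (idx_coarser (leqnSn n) xy)).
Qed.

Lemma projected_diff_orthogonal N r v n j (u : R -> R) : (n < N)%N -> level n u ->
  unit_integral P N j (fun x => u x * projected_diff N r v n.+1 x) = 0.
Proof.
move=> nN Lu; have [jr|jr] := boolP (j \in r); last first.
  rewrite (@eq_unit_integral _ _ _ _ _ (fun=> 0)) ?unit_integral0// => x xj.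
  by rewrite /projected_diff xj (negbTE jr) andbF mulr0.
rewrite (@eq_unit_integral _ _ _ _ _ (fun x => u x * cond_mean P N n.+1 (v n.+1) x -
    u x * cond_mean P N n (v n.+1) x)); last first.
  by move=> x xj; rewrite /projected_diff xj jr nN mulrBr.
rewrite unit_integralB.
rewrite (unit_integral_mul_cond_mean _ _ _ (level_le (leqnSn n) Lu)).
by rewrite unit_integral_mul_cond_mean// subrr.
Qed.

Lemma finite_test N r v : finite_martingale P N r (test_martingale N r v).
Proof.
split.
- apply: martingale_of_diffs => [n|n j k]; first exact: level_projected_diff.
  have [nN|Nn] := ltnP n N; last first.
    rewrite (@eq_unit_integral _ _ _ _ _ (fun=> 0)) ?unit_integral0// => x xj.
    by rewrite /projected_diff ltnNge Nn mulr0.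
  have Lk : level n (fun x : R => (idx n x == k)%:R : R) by move=> x y ->.
  rewrite -(unit_integral_level P j nN); first exact: projected_diff_orthogonal.
  exact: (level_comp2 (fun a b => a * b) (level_le (leqnSn n) Lk)
    (@level_projected_diff N r v n)).
- by case=> // n x Nn; rewrite mdiff_test /projected_diff leqNgt Nn.
- by case=> // n x xr; rewrite mdiff_test /projected_diff (negbTE xr) andbF.
Qed.

Lemma kappa_test N r v g : is_martingale P g -> uniq r ->
  kappa P g (test_martingale N r v) =
  \sum_(j <- r) unit_integral P N j (fun x => \sum_(k < N) v k.+1 x * mdiff g k.+1 x).
Proof.
move=> gm ur; rewrite (finite_kappa (finite_test N r v) gm ur) exchange_big /=.
rewrite big_seq [RHS]big_seq; apply: eq_bigr => j jr.
rewrite [RHS]unit_integral_sum; apply: eq_bigr => k _.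
have kN := ltn_ord k.
rewrite (@eq_unit_integral _ _ _ _ _ (fun x => mdiff g k.+1 x * cond_mean P N k.+1 (v k.+1) x -
    cond_mean P N k (v k.+1) x * mdiff g k.+1 x)); last first.
  by move=> x xj; rewrite mdiff_test /projected_diff xj jr kN /=; ring.
rewrite unit_integralB (mdiff_orthogonal j gm kN (@level_cond_mean _ _ _ _ _)) subr0.
rewrite (unit_integral_mul_cond_mean _ _ _ (mdiff_level (n := k.+1) gm)).
by apply: eq_unit_integral => x _; rewrite mulrC.
Qed.

(** The levels [l] are left free because the same weights are averaged both at their own level and
    at the level before. *)
Lemma dual_doob_unit_integral p N j (l : nat -> nat) w n : 1 < p ->
  (forall k, (l k <= l k.+1)%N) -> (forall k x, 0 <= w k x) ->
  unit_integral P N j (fun x => (\sum_(k < n) cond_mean P N (l k) (w k) x) `^ p) <=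
  p `^ p * unit_integral P N j (fun x => (\sum_(k < n) w k x) `^ p).
Proof.
move=> p1 ll w0.
have := @dual_doob R _ _ (@atom_mass R P N j) (fun i => atom_mass_ge0 P j i) p
  (fun k i => idx (l k) (atom_pt R j i)) (fun k i => w k (atom_pt R j i)) n p1
  (fun k s t => @idx_coarser R _ _ _ _ (ll k)) (fun k i => w0 k _).
rewrite /unit_integral; apply: le_trans; apply: ler_sum => i _.
rewrite (eq_bigr (fun k : 'I_n => class_mean (@atom_mass R P N j)
  (fun i => idx (l k) (atom_pt R j i)) (fun i => w k (atom_pt R j i)) (idx (l k) (atom_pt R j i)))).
  exact: lexx.
by move=> k _; rewrite cond_mean_atom_pt.
Qed.

Lemma le_cond_mean N n (u u' : R -> R) x : (forall y, `|u y| <= u' y) ->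
  `|cond_mean P N n u x| <= cond_mean P N n u' x.
Proof.
move=> uu'; rewrite /cond_mean /class_mean normrM.
have M0 : 0 <= (\sum_(s : 'I_(2 ^ N) | idx n (atom_pt R (idx 0 x) s) == idx n x)
      atom_mass P (idx 0 x) s)^-1.
  by rewrite invr_ge0 sumr_ge0// => s _; exact: atom_mass_ge0.
rewrite (ger0_norm M0); apply: ler_wpM2r => //.
apply: le_trans (ler_norm_sum _ _ _) _; apply: ler_sum => s _.
by rewrite normrM ger0_norm ?atom_mass_ge0//; apply: ler_wpM2l; rewrite ?atom_mass_ge0.
Qed.

(** In the constant, 2^p comes from separating the averages at levels k+1 and k, p^p from the dual
    Doob inequality, and the factor 2 from using it for both. *)
Lemma moment_test_le p N r v w j : 1 < p ->
  (forall k x, `|v k x| <= w k x) ->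
  unit_moment P p (variation_upto (test_martingale N r v)) j N <=
  (2 * 2 `^ p * p `^ p) * unit_integral P N j (fun x => (\sum_(k < N) w k.+1 x) `^ p).
Proof.
move=> p1 vw; have p0 : 0 < p by rewrite (lt_trans _ p1).
have w0 k x : 0 <= w k x by apply: le_trans (vw k x).
pose S1 x := \sum_(k < N) cond_mean P N k.+1 (w k.+1) x.
pose S2 x := \sum_(k < N) cond_mean P N k (w k.+1) x.
have S10 x : 0 <= S1 x by apply: sumr_ge0 => k _; exact: cond_mean_ge0.
have S20 x : 0 <= S2 x by apply: sumr_ge0 => k _; exact: cond_mean_ge0.
apply: (@le_trans _ _ (unit_integral P N j (fun x => 2 `^ p * (S1 x `^ p + S2 x `^ p)))).
  apply: le_unit_integral => x _; apply: le_trans (powRD_le2 (ltW p0) (S10 x) (S20 x)).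
  apply: ge0_ler_powR; rewrite ?nnegrE ?(ltW p0) ?addr_ge0//.
    by apply: sumr_ge0.
  rewrite /variation_upto big_ord_recl mdiff0 normr0 add0r -big_split.
  apply: ler_sum => k _; rewrite lift0 mdiff_test /projected_diff.
  rewrite [leRHS]/=; case: ifP => _; last by rewrite normr0 addr_ge0 ?cond_mean_ge0.
  by apply: le_trans (ler_normB _ _) _; apply: lerD; exact: le_cond_mean.
rewrite unit_integralZ unit_integralD.
have H1 := @dual_doob_unit_integral p N j S (fun k => w k.+1) N p1
  (fun k => leqnSn _) (fun k => w0 k.+1).
have H2 := @dual_doob_unit_integral p N j id (fun k => w k.+1) N p1
  (fun k => leqnSn _) (fun k => w0 k.+1).
set A := unit_integral P N j (fun x => (\sum_(k < N) w k.+1 x) `^ p) in H1 H2 *.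
have -> : 2 * 2 `^ p * p `^ p * A = 2 `^ p * (p `^ p * A + p `^ p * A) by ring.
by apply: (ler_wpM2l (powR_ge0 2 p)); exact: lerD.
Qed.

End TestMartingale.

Section MaximalBound.
Variables (R : realType) (P : probability (dyadic_line R) R).
Implicit Types (f g : nat -> dyadic_line R -> R) (r : seq int).

Definition argmaxdiff g (n : nat) (x : R) : 'I_n.+1 :=
  [arg max_(k > ord0) `|mdiff g k x|]%O.

Lemma maxdiff_arg g n x : maxdiff_upto g n x = `|mdiff g (argmaxdiff g n x) x|.
Proof. by rewrite /maxdiff_upto (bigmax_eq_arg 0 ord0)// => k _; exact: normr_ge0. Qed.

Variables (p q p' q' : R).
Hypotheses (hp : 1 < p) (hq : 1 < q).
Hypotheses (hp' : p^-1 + p'^-1 = 1) (hq' : q^-1 + q'^-1 = 1).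

Let p0 : 0 < p. Proof. by rewrite (lt_trans _ hp). Qed.
Let q0 : 0 < q. Proof. by rewrite (lt_trans _ hq). Qed.
Let p'0 : 0 < p'. Proof. by have [] := conjugate_exponentE hp hp'. Qed.
Let q'0 : 0 < q'. Proof. by have [] := conjugate_exponentE hq hq'. Qed.

(** The p-th root of the constant for p-th moments in [moment_test_le], that is 2^(1/p) 2 p. *)
Definition projection_const : R := (2 * 2 `^ p * p `^ p) `^ p^-1.

Lemma projection_const_gt0 : 0 < projection_const.
Proof. by rewrite powR_gt0// !mulr_gt0// powR_gt0. Qed.

(* On the j-th interval the dual weight of [s = maxdiff_upto g n] is
   [a_j ^ (q'/p' - 1) s ^ (p' - 1)] with [a_j] the p'-moment of [s]. It is split
   along the level at which the maximum is attained, and the pieces are turned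
   into martingale differences by projection. *)
Lemma maxdiff_sum_le g (rho K : R) r n : 0 < rho -> is_martingale P g -> uniq r ->
  (forall N f, finite_martingale P N r f -> (G_norm P p q f <= rho%:E)%E ->
    `|kappa P g f| <= K) ->
  amalgam_sum P p' q' (maxdiff_upto g) r n <= (projection_const * K / rho) `^ q'.
Proof.
move=> rho0 gm ur gK; set s := maxdiff_upto g n.
have s0 x : 0 <= s x by exact: bigmax_ge_id.
set B := amalgam_sum _ _ _ _ _ _.
have B0 : 0 <= B by exact: amalgam_sum_ge0.
have [->|Bn0] := eqVneq B 0; first exact: powR_ge0.
have Bpos : 0 < B by rewrite lt_neqAle eq_sym Bn0.
have c0 := projection_const_gt0; set c := projection_const in c0 *.
pose a j := unit_moment P p' (maxdiff_upto g) j n.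
have a0 j : 0 <= a j by exact: unit_moment_ge0.
(* The scaling that brings the test martingale into the ball of radius [rho]: its norm is at most c
   tau B^(1/q). *)
pose tau := rho / (c * B `^ q^-1).
have tau0 : 0 < tau by rewrite divr_gt0// mulr_gt0// powR_gt0.
pose lam j := a j `^ (q' / p' - 1).
pose u x := tau * (lam (idx 0 x) * s x `^ (p' - 1)).
have u0 x : 0 <= u x by rewrite mulr_ge0 ?(ltW tau0)// mulr_ge0// powR_ge0.
pose w (k : nat) x := (argmaxdiff g n x == k :> nat)%:R * u x.
pose v (k : nat) x := Num.sg (mdiff g k x) * w k x.
have w0 k x : 0 <= w k x by rewrite mulr_ge0.
have vw k x : `|v k x| <= w k x.
  rewrite normrM (ger0_norm (w0 k x)) ler_piMl//.
  by rewrite normr_sg; case: (_ == 0).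
have wu x : \sum_(k < n) w k.+1 x <= u x.
  case e : (nat_of_ord (argmaxdiff g n x)) => [|m].
    by rewrite big1// => k _; rewrite /w e mul0r.
  have mn : (m < n)%N by rewrite -ltnS -e ltn_ord.
  rewrite (bigD1 (Ordinal mn))//= /w e eqxx mul1r big1 ?addr0// => k kn.
  have -> : (m.+1 == k.+1) = false; last by rewrite mul0r.
  by apply: contraNF kn => /eqP[mk]; apply/eqP/val_inj.
have vd x : \sum_(k < n) v k.+1 x * mdiff g k.+1 x = u x * s x.
  have E k : v k x * mdiff g k x = w k x * `|mdiff g k x|.
    by rewrite /v mulrAC mulrC normrEsg.
  under eq_bigr do rewrite E.
  (* If the maximum is attained at index 0, it equals |d_0 g| = 0 and both sides vanish; so nothing
     is lost by summing from index 1. *)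
  case e : (nat_of_ord (argmaxdiff g n x)) => [|m].
    have sx : s x = 0 by rewrite /s maxdiff_arg e mdiff0 normr0.
    by rewrite sx mulr0 big1// => k _; rewrite /w e !mul0r.
  have mn : (m < n)%N by rewrite -ltnS -e ltn_ord.
  have sx : s x = `|mdiff g m.+1 x| by rewrite /s maxdiff_arg e.
  rewrite (bigD1 (Ordinal mn))//= /w e eqxx mul1r -sx big1 ?addr0// => k kn.
  have -> : (m.+1 == k.+1) = false; last by rewrite !mul0r.
  by apply: contraNF kn => /eqP[mk]; apply/eqP/val_inj.
pose f := test_martingale P n r v.
have ff : finite_martingale P n r f by exact: finite_test.
have unit_integralus j : unit_integral P n j (fun x => u x * s x) = tau * a j `^ (q' / p').
  rewrite (@eq_unit_integral _ _ _ _ _ (fun x => (tau * lam j) * s x `^ p')); last first.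
    move=> x xj; rewrite /u xj -(mulr_powRB1 (s0 x) p'0); ring.
  rewrite unit_integralZ -mulrA -(mulr_powRB1 (a0 j) (divr_gt0 q'0 p'0)).
  by congr (_ * _); rewrite mulrC.
have kf : kappa P g f = tau * B.
  rewrite (kappa_test n v gm ur) /B /amalgam_sum mulr_sumr; apply: eq_bigr => j _.
  by rewrite -unit_integralus; apply: eq_unit_integral => x _; exact: vd.
have unit_integralup j : unit_integral P n j (fun x => u x `^ p) = tau `^ p * (lam j `^ p * a j).
  rewrite (@eq_unit_integral _ _ _ _ _ (fun x => (tau `^ p * lam j `^ p) * s x `^ p')).
    by rewrite unit_integralZ -mulrA.
  move=> x xj; rewrite /u xj powRM ?(ltW tau0)//; last first.
    by rewrite mulr_ge0// powR_ge0.
  rewrite powRM ?powR_ge0// -mulrA; congr (_ * (_ * _)).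
  by rewrite -powRrM; have [_ -> _] := conjugate_exponentE hp hp'.
have qp0 : 0 < q / p by rewrite divr_gt0.
have pos : 0 <= 2 * 2 `^ p * p `^ p.
  by rewrite mulr_ge0 ?powR_ge0// mulr_ge0 ?powR_ge0.
have mom j : unit_moment P p (variation_upto f) j n `^ (q / p) <=
    (c * tau) `^ q * a j `^ (q' / p').
  have lap : 0 <= lam j `^ p * a j by rewrite mulr_ge0 ?powR_ge0.
  have H : unit_moment P p (variation_upto f) j n <=
      (2 * 2 `^ p * p `^ p) * (tau `^ p * (lam j `^ p * a j)).
    apply: (le_trans (@moment_test_le R P p n r v w j hp vw)).
    rewrite -unit_integralup; apply: (ler_wpM2l pos); apply: le_unit_integral => x _.
    by apply: ge0_ler_powR; rewrite ?nnegrE ?(ltW p0) ?sumr_ge0.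
  apply: (@le_trans _ _ ((2 * 2 `^ p * p `^ p * (tau `^ p * (lam j `^ p * a j))) `^ (q / p))).
    apply: ge0_ler_powR H; rewrite ?nnegrE ?(ltW qp0) ?unit_moment_ge0//.
    by rewrite mulr_ge0// mulr_ge0 ?powR_ge0.
  have qE : p * (q / p) = q by rewrite mulrCA divff ?mulr1// gt_eqF.
  have X z : (z `^ p) `^ (q / p) = z `^ q by rewrite -powRrM qE.
  have cE : (2 * 2 `^ p * p `^ p) `^ (q / p) = c `^ q.
    by rewrite /c /projection_const -powRrM (mulrC p^-1).
  rewrite (powRM _ pos (mulr_ge0 (powR_ge0 tau p) lap)) cE.
  rewrite (powRM _ (powR_ge0 tau p) lap) (powRM _ (powR_ge0 (lam j) p) (a0 j)).
  rewrite (X tau) (X (lam j)) (powRM _ (ltW c0) (ltW tau0)) -mulrA.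
  apply: ler_wpM2l; first exact: powR_ge0.
  apply: ler_wpM2l; first exact: powR_ge0.
  (* The exponent q'/p' - 1 may be negative, so exponents are added only for a nonzero base. *)
  have [->|aj] := eqVneq (a j) 0.
    by rewrite !powR0 ?mulr0// gt_eqF// divr_gt0.
  rewrite /lam -powRrM -powRD; last by rewrite aj implybT.
  have -> : (q' / p' - 1) * q + q / p = q' / p'.
    have p'n : p' != 0 by rewrite gt_eqF.
    have [_ e2 _] := conjugate_exponentE hq hq'.
    have e3 : p^-1 = 1 - p'^-1 by rewrite -hp' addrK.
    have e4 : q' * q = q' + q by rewrite -[X in _ = X + _]e2; ring.
    by rewrite e3 mulrBl mul1r mulrAC e4; ring.
  exact: lexx.
have fG : (G_norm P p q f <= rho%:E)%E.
  apply: le_trans (finite_G_norm_le p0 q0 ff ur) _; rewrite lee_fin.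
  have H : amalgam_sum P p q (variation_upto f) r n <= (c * tau) `^ q * B.
    by rewrite /B /amalgam_sum mulr_sumr; apply: ler_sum => j _; exact: mom.
  apply: (@le_trans _ _ (((c * tau) `^ q * B) `^ q^-1)).
    apply: ge0_ler_powR H; rewrite ?nnegrE ?invr_ge0 ?(ltW q0) ?amalgam_sum_ge0//.
    by rewrite mulr_ge0 ?powR_ge0.
  have ct : 0 <= c * tau by rewrite mulr_ge0 ?ltW.
  rewrite (powRM _ (powR_ge0 _ _) B0) (powRK_inv q0 ct) /tau.
  have Bq : B `^ q^-1 != 0 by rewrite gt_eqF// powR_gt0.
  rewrite le_eqVlt; apply/orP; left; apply/eqP; field.
  by rewrite Bq gt_eqF.
have := gK n f ff fG; rewrite kf ger0_norm; last by rewrite mulr_ge0// ltW.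
move=> tB.
(* With this factorisation tau B <= K becomes (rho / c) B^(1/q') <= K, which is the claim up to the
   power q'. *)
have BE : B = B `^ q^-1 * B `^ q'^-1.
  by rewrite -powRD hq' ?oner_eq0// powRr1.
have Bq' : B `^ q'^-1 <= c * K / rho.
  rewrite ler_pdivlMr//.
  have Bq : 0 < B `^ q^-1 by rewrite powR_gt0.
  have e : tau * B = rho / c * B `^ q'^-1.
    by rewrite [X in _ * X = _]BE /tau; field; rewrite !gt_eqF.
  move: tB; rewrite e mulrAC ler_pdivrMr// => tB.
  by rewrite mulrC (mulrC c).
rewrite -[leLHS](powR_invK q'0 B0).
apply: (ge0_ler_powR (ltW q'0) _ _ Bq'); rewrite ?nnegrE ?powR_ge0//.
by apply: le_trans Bq'; exact: powR_ge0.
Qed.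

(** A bound on a ball of any radius is accepted: the norm equivalence takes [rho] = 1 and [K] the
    operator norm, surjectivity takes a radius given by continuity at 0 and [K] = 1. *)
Lemma BD_norm_le_dual g (rho K : R) : 0 < rho -> 0 <= K -> is_martingale P g ->
  (forall N r f, uniq r -> finite_martingale P N r f -> (G_norm P p q f <= rho%:E)%E ->
    `|kappa P g f| <= K) ->
  (BD_norm P p' q' g <= (projection_const * K / rho)%:E)%E.
Proof.
move=> rho0 K0 gm H; apply: BD_norm_le => //.
  by rewrite divr_ge0 ?(ltW rho0)// mulr_ge0// ltW// projection_const_gt0.
move=> r n ur; apply: maxdiff_sum_le => // N f; exact: H.
Qed.

End MaximalBound.

(** * Representation of functionals *)

Section NullMartingales.
Variables (R : realType) (P : probability (dyadic_line R) R).
Implicit Types (f g h : nat -> dyadic_line R -> R) (r : seq int).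

Lemma mdiff_sum (I : Type) (s : seq I) (F : I -> nat -> dyadic_line R -> R) n x :
  mdiff (\sum_(i <- s) F i) n x = \sum_(i <- s) mdiff (F i) n x.
Proof.
elim: s => [|i s IH].
  rewrite !big_nil; case: n => [|n]; first by rewrite mdiff0.
  by rewrite mdiffS subrr.
by rewrite !big_cons -IH -[F i in LHS]scale1r mdiffE_lin mul1r.
Qed.

Lemma martingale_sum_mdiff f n x : is_martingale P f ->
  f n x = \sum_(k < n) mdiff f k.+1 x.
Proof.
move=> [f0 _]; rewrite -(big_mkord xpredT (fun k => mdiff f k.+1 x)).
rewrite (eq_bigr (fun k => f k.+1 x - f k x)) => [|k _]; last by rewrite mdiffS.
by rewrite (telescope_sumr (fun k => f k x))// f0 subr0.
Qed.

Lemma finite_martingale0 N r : finite_martingale P N r 0.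
Proof.
have E n x : mdiff (0 : nat -> dyadic_line R -> R) n x = 0.
  by case: n => [|n]; rewrite ?mdiff0// mdiffS subrr.
split=> //; apply/martingaleP; split=> // n j k.
by rewrite (@eq_unit_integral _ _ _ _ _ (fun=> 0)) ?unit_integral0// => x _; rewrite E mulr0.
Qed.

Lemma finite_martingale_sum (I : eqType) (s : seq I) N r
    (F : I -> nat -> dyadic_line R -> R) :
  (forall i, i \in s -> finite_martingale P N r (F i)) ->
  finite_martingale P N r (\sum_(i <- s) F i).
Proof.
elim: s => [|i s IH] H; first by rewrite big_nil; exact: finite_martingale0.
rewrite big_cons -[F i]scale1r; apply: finite_martingale_lin.
  by apply: H; rewrite mem_head.
by apply: IH => k ks; apply: H; rewrite inE ks orbT.
Qed.

Lemma finite_martingale_sub N r f h : finite_martingale P N r f ->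
  finite_martingale P N r h -> finite_martingale P N r (f - h).
Proof.
move=> ff hf; rewrite (_ : f - h = (-1) *: h + f); last by rewrite scaleN1r addrC.
exact: finite_martingale_lin.
Qed.

Lemma finite_martingale_le N N' r r' f : (N <= N')%N -> {subset r <= r'} ->
  finite_martingale P N r f -> finite_martingale P N' r' f.
Proof.
move=> NN rr [fm fN fr]; split=> // n x; first by move=> /(leq_ltn_trans NN)/fN.
by move=> xr; apply: fr; apply: contra xr => /rr.
Qed.

Lemma unit_integral_abs_eq0 n j (u : R -> R) :
  (unit_integral P n j (fun x => `|u x|) = 0) <->
  (forall i : 'I_(2 ^ n), atom_mass P j i * u (atom_pt R j i) = 0).
Proof.
have ge0 (i : 'I_(2 ^ n)) : true -> 0 <= atom_mass P j i * `|u (atom_pt R j i)|.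
  by move=> _; rewrite mulr_ge0 ?atom_mass_ge0.
have E (i : 'I_(2 ^ n)) : (atom_mass P j i * `|u (atom_pt R j i)| == 0) =
    (atom_mass P j i * u (atom_pt R j i) == 0).
  by rewrite !mulf_eq0 normr_eq0.
split=> [/eqP|H].
  rewrite /unit_integral psumr_eq0// => /allP H i; apply/eqP; rewrite -E.
  by apply: (H i); rewrite mem_index_enum.
by rewrite /unit_integral big1// => i _; apply/eqP; rewrite E H.
Qed.

Lemma finite_G_norm_eq0 p q N r f : 0 < p -> 0 < q -> uniq r ->
  finite_martingale P N r f ->
  (forall n j, (n < N)%N -> j \in r -> unit_integral P n.+1 j (fun x => `|mdiff f n.+1 x|) = 0) ->
  (G_norm P p q f = 0)%E.
Proof.
move=> p0 q0 ur ff H; have [fm _ _] := ff.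
apply/eqP; rewrite eq_le G_norm_ge0 andbT.
apply: le_trans (finite_G_norm_le p0 q0 ff ur) _; rewrite lee_fin.
have -> : amalgam_sum P p q (variation_upto f) r N = 0.
  rewrite /amalgam_sum big_seq big1// => j jr.
  have -> : unit_moment P p (variation_upto f) j N = 0.
    rewrite /unit_moment /unit_integral big1// => i _.
    have [->|wi] := eqVneq (atom_mass P j i) 0; first by rewrite mul0r.
    rewrite /variation_upto big_ord_recl mdiff0 normr0 add0r big1 ?powR0 ?mulr0 ?gt_eqF//.
    move=> k _; rewrite lift0.
    have kN := ltn_ord k; have := H k j kN jr.
    have L := level_comp (fun a => `|a|) (mdiff_level (n := k.+1) fm).
    rewrite -(unit_integral_level P j kN L) => /unit_integral_abs_eq0/(_ i)/eqP.
    by rewrite mulf_eq0 (negbTE wi) /= => /eqP ->; rewrite normr0.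
  by rewrite powR0// gt_eqF// divr_gt0.
by rewrite powR0 ?lexx// invr_neq0// gt_eqF.
Qed.

End NullMartingales.

Section Duality.
Variables (R : realType) (P : probability (dyadic_line R) R).
Implicit Types (f g h : nat -> dyadic_line R -> R) (r : seq int) (u : R -> R).

Definition elementary (n : nat) (j : int) u : nat -> dyadic_line R -> R :=
  test_martingale P n [:: j] (fun m => if m == n then u else fun=> 0).

Lemma finite_elementary n j u : finite_martingale P n [:: j] (elementary n j u).
Proof. exact: finite_test. Qed.

Lemma cond_mean_lin N n a u u' x : cond_mean P N n (fun y => a * u y + u' y) x =
  a * cond_mean P N n u x + cond_mean P N n u' x.
Proof.
rewrite /cond_mean /class_mean mulrA mulr_sumr -mulrDl -big_split; congr (_ / _).
by apply: eq_bigr => i _ /=; ring.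
Qed.

Lemma cond_mean_cst0 N n x : cond_mean P N n (fun=> 0) x = 0.
Proof. by apply: cond_mean_eq0 => k; rewrite /unit_integral big1// => i _; rewrite !mulr0. Qed.

Lemma mdiff_elementary n j u m x : mdiff (elementary n.+1 j u) m.+1 x =
  if (m == n) && (idx 0 x == j)
  then cond_mean P n.+1 n.+1 u x - cond_mean P n.+1 n u x else 0.
Proof.
rewrite mdiff_test /projected_diff inE eqSS.
have [->|mn] /= := eqVneq m n; first by rewrite leqnn.
by case: ifP => // _; rewrite !cond_mean_cst0 subrr.
Qed.

(** The equality holds everywhere and not only almost surely, since [cond_mean] is an explicit
    formula linear in its argument; linearity of a functional can thus be applied directly. *)
Lemma elementary_lin n j a u u' :
  elementary n.+1 j (fun x => a * u x + u' x) =
  a *: elementary n.+1 j u + elementary n.+1 j u'.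
Proof.
have fm := finite_elementary n.+1 j.
apply/funext => m; apply/funext => x.
have [m1 _ _] := fm (fun x => a * u x + u' x).
have [m2 _ _] := finite_martingale_lin a (fm u) (fm u').
rewrite (martingale_sum_mdiff m x m1) (martingale_sum_mdiff m x m2).
apply: eq_bigr => k _; rewrite mdiffE_lin !mdiff_elementary.
by case: ifP => _; rewrite ?cond_mean_lin; ring.
Qed.

Lemma elementary0 n j : elementary n.+1 j (fun=> 0) = 0.
Proof.
have [m1 _ _] := finite_elementary n.+1 j (fun=> 0).
apply/funext => m; apply/funext => x.
rewrite (martingale_sum_mdiff m x m1) big1// => k _.
by rewrite mdiff_elementary !cond_mean_cst0 subrr; case: ifP.
Qed.

Lemma eq_elementary n j u u' : (forall i : 'I_(2 ^ n.+1), u (atom_pt R j i) = u' (atom_pt R j i)) ->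
  elementary n.+1 j u = elementary n.+1 j u'.
Proof.
move=> uu; have fm := finite_elementary n.+1 j.
apply/funext => m; apply/funext => x.
have [m1 _ _] := fm u; have [m2 _ _] := fm u'.
rewrite (martingale_sum_mdiff m x m1) (martingale_sum_mdiff m x m2).
apply: eq_bigr => k _; rewrite !mdiff_elementary.
case: ifP => // /andP[_ /eqP xj].
have E l : cond_mean P n.+1 l u x = cond_mean P n.+1 l u' x.
  rewrite /cond_mean /class_mean xj; congr (_ / _).
  by apply: eq_bigr => i _; rewrite uu.
by rewrite !E.
Qed.

Variables (p q : R) (phi : (nat -> dyadic_line R -> R) -> R).
Hypotheses (p0 : 0 < p) (q0 : 0 < q) (phiG : G_dual P p q phi).

Lemma dual_finite_lin N r a f h : uniq r -> finite_martingale P N r f ->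
  finite_martingale P N r h -> phi (a *: f + h) = a * phi f + phi h.
Proof.
move=> ur ff hf; apply: phiG.1; first exact: finite_G_space ff ur.
exact: finite_G_space hf ur.
Qed.

Lemma dual0 : phi 0 = 0.
Proof.
have f0 := @finite_martingale0 R P 0 [::].
have := @dual_finite_lin 0 [::] 1 0 0 isT f0 f0.
by rewrite scale1r addr0 mul1r => /eqP; rewrite -subr_eq subrr => /eqP <-.
Qed.

Lemma dual_sum (I : eqType) (s : seq I) N r (F : I -> nat -> dyadic_line R -> R) :
  uniq r -> (forall i, i \in s -> finite_martingale P N r (F i)) ->
  phi (\sum_(i <- s) F i) = \sum_(i <- s) phi (F i).
Proof.
move=> ur; elim: s => [|i s IH] H; first by rewrite !big_nil dual0.
have Hs k : k \in s -> finite_martingale P N r (F k).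
  by move=> ks; apply: H; rewrite inE ks orbT.
rewrite !big_cons -[F i in LHS]scale1r (dual_finite_lin _ ur _ (finite_martingale_sum Hs)).
  by rewrite mul1r IH.
by apply: H; rewrite mem_head.
Qed.

(** Here f - h has norm 0, hence lies in every ball around 0, and continuity at h makes the
    difference of the values smaller than every e > 0. This replaces a quotient by almost sure
    equality. *)
Lemma eq_dual_null N r f h : uniq r -> finite_martingale P N r f ->
  finite_martingale P N r h ->
  (forall n j, (n < N)%N -> j \in r ->
    unit_integral P n.+1 j (fun x => `|mdiff f n.+1 x - mdiff h n.+1 x|) = 0) ->
  phi f = phi h.
Proof.
move=> ur ff hf H; apply/eqP; rewrite -subr_eq0 -normr_le0.
apply/ler_addgt0Pr => e e0; rewrite add0r ltW//.
have [d d0 dP] := phiG.2 h (finite_G_space p0 q0 hf ur) e e0.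
apply: dP; first exact: finite_G_space ff ur.
rewrite (finite_G_norm_eq0 p0 q0 ur (finite_martingale_sub ff hf)) ?lte_fin//.
move=> n j nN jr; rewrite -[RHS](H n j nN jr).
by apply: eq_unit_integral => x _; rewrite mdiffE_sub.
Qed.

(* When the dyadic interval is null, so is [elementary] of its indicator, and
   numerator and denominator vanish together. *)
Definition dual_diff (n : nat) (x : R) : R :=
  phi (elementary n (idx 0 x) (fun y => (idx n y == idx n x)%:R)) /
  fine (P [set y | idx n y = idx n x]).

Lemma level_dual_diff n : level n (dual_diff n).
Proof.
by move=> x y xy; rewrite /dual_diff (idx_coarser (leq0n _) xy) xy.
Qed.

Lemma atom_mass_dual_diff n j (i : 'I_(2 ^ n.+1)) :
  atom_mass P j i * dual_diff n.+1 (atom_pt R j i) =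
  phi (elementary n.+1 j (fun y => (idx n.+1 y == atom n.+1 j i)%:R)).
Proof.
rewrite /dual_diff idx0_atom_pt idx_atom_pt; set u := fun y => _.
rewrite -/(atom_mass P j i).
have [w0|wn] := eqVneq (atom_mass P j i) 0; last by rewrite mulrC divfK.
rewrite w0 mul0r -dual0; apply: (@eq_dual_null n.+1 [:: j]) => //.
- exact: finite_martingale0.
- exact: finite_elementary.
have cu l x : idx 0 x = j -> cond_mean P n.+1 l u x = 0.
  move=> xj; apply: cond_mean_eq0 => k; rewrite xj /unit_integral big1// => i' _.
  rewrite /u idx_atom_pt; have [e|] := eqVneq (atom n.+1 j i') (atom n.+1 j i); last first.
    by move=> _; rewrite !mulr0.
  have -> : i' = i by apply: val_inj => /=; move: e; rewrite /atom => e; lia.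
  by rewrite w0 mul0r.
move=> m j' mn; rewrite inE => /eqP ->.
rewrite (@eq_unit_integral _ _ _ _ _ (fun=> 0)) ?unit_integral0// => x xj.
rewrite mdiff_elementary xj !cu// subrr.
rewrite [mdiff 0 _ _](_ : _ = 0); first by case: ifP; rewrite subrr normr0.
by rewrite mdiffS subrr.
Qed.

(** Only the values of [u] at the points [atom_pt] matter, and there [u] is a combination of
    indicators of atoms; linearity reduces the claim to [atom_mass_dual_diff]. *)
Lemma unit_integral_dual_diff n j u :
  unit_integral P n.+1 j (fun x => u x * dual_diff n.+1 x) = phi (elementary n.+1 j u).
Proof.
pose ind (i : 'I_(2 ^ n.+1)) (y : R) : R := (idx n.+1 y == atom n.+1 j i)%:R.
have -> : phi (elementary n.+1 j u) =
    phi (elementary n.+1 j (fun y => \sum_(i < 2 ^ n.+1) u (atom_pt R j i) * ind i y)).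
  congr phi; apply: eq_elementary => i; rewrite (bigD1 i)//= /ind idx_atom_pt eqxx mulr1.
  rewrite big1 ?addr0// => i' i'i.
  have -> : (atom n.+1 j i == atom n.+1 j i') = false; last by rewrite mulr0.
  apply: contraNF i'i => /eqP e; apply/eqP/val_inj => /=.
  by move: e; rewrite /atom => e; lia.
have sumP (s : seq 'I_(2 ^ n.+1)) :
    phi (elementary n.+1 j (fun y => \sum_(i <- s) u (atom_pt R j i) * ind i y)) =
    \sum_(i <- s) u (atom_pt R j i) * phi (elementary n.+1 j (ind i)).
  elim: s => [|i s IH].
    rewrite big_nil (_ : (fun y => _) = (fun=> 0)) ?elementary0 ?dual0//.
    by apply/funext => y; rewrite big_nil.
  rewrite big_cons -IH.
  rewrite (_ : (fun y => _) = (fun y => u (atom_pt R j i) * ind i y +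
    \sum_(i <- s) u (atom_pt R j i) * ind i y)); last first.
    by apply/funext => y; rewrite big_cons.
  rewrite elementary_lin (@dual_finite_lin n.+1 [:: j])//; exact: finite_elementary.
rewrite sumP; apply: eq_bigr => i _.
by rewrite mulrCA atom_mass_dual_diff.
Qed.

Definition dual_martingale := of_diffs dual_diff.

Lemma mdiff_dual n x : mdiff dual_martingale n.+1 x = dual_diff n.+1 x.
Proof. exact: mdiff_of_diffs. Qed.

Lemma atom_mass_cond_mean_level n m j u (i : 'I_(2 ^ n)) : level m u ->
  atom_mass P j i * cond_mean P n m u (atom_pt R j i) = atom_mass P j i * u (atom_pt R j i).
Proof.
move=> Lu; rewrite cond_mean_atom_pt (mass_class_mean (fun t => atom_mass_ge0 P j t))//.
by move=> s /Lu.
Qed.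

(** For the indicator of an interval of level n, E_(n+1) and E_n agree up to null atoms; the
    elementary martingale of level n+1 built on it is therefore null and [phi] sends it to 0. *)
Lemma dual_martingaleP : is_martingale P dual_martingale.
Proof.
apply: martingale_of_diffs => [n|n j k]; first exact: level_dual_diff.
have Lk : level n (fun x : R => (idx n x == k)%:R : R) by move=> x y ->.
rewrite unit_integral_dual_diff -dual0; apply: (@eq_dual_null n.+1 [:: j]) => //.
- exact: finite_elementary.
- exact: finite_martingale0.
move=> m j' mn; rewrite inE => /eqP ->.
have [->|mn'] := eqVneq m n; last first.
  rewrite (@eq_unit_integral _ _ _ _ _ (fun=> 0)) ?unit_integral0// => x xj.
  by rewrite mdiff_elementary (negbTE mn') mdiffS !subrr normr0.
apply/unit_integral_abs_eq0 => i.
rewrite mdiff_elementary eqxx idx0_atom_pt eqxx mdiffS subrr subr0.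
by rewrite mulrBr !atom_mass_cond_mean_level ?subrr//; exact: level_le (leqnSn n) Lk.
Qed.

(** Up to null atoms f is the sum of the elementary martingales of its own differences, because
    E_(n+1) fixes d_(n+1) f and E_n annihilates it. *)
Lemma dual_finite N r f : uniq r -> finite_martingale P N r f ->
  phi f = kappa P dual_martingale f.
Proof.
move=> ur ff; have [fm fN fr] := ff.
rewrite (finite_kappa ff dual_martingaleP ur).
have fe (k : 'I_N) j : j \in r ->
    finite_martingale P N r (elementary k.+1 j (mdiff f k.+1)).
  move=> jr; apply: finite_martingale_le (finite_elementary _ _ _); first exact: ltn_ord.
  by move=> i; rewrite inE => /eqP ->.
have fs (k : 'I_N) : k \in index_enum 'I_N -> finite_martingale P N r
    (\sum_(j <- r) elementary k.+1 j (mdiff f k.+1)).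
  by move=> _; apply: finite_martingale_sum => j; exact: fe.
pose h := \sum_(k < N) \sum_(j <- r) elementary k.+1 j (mdiff f k.+1).
have hf : finite_martingale P N r h by exact: finite_martingale_sum.
transitivity (phi h).
  apply: (eq_dual_null ur ff hf) => n j nN jr; apply/unit_integral_abs_eq0 => i.
  have -> : mdiff h n.+1 (atom_pt R j i) = cond_mean P n.+1 n.+1 (mdiff f n.+1) (atom_pt R j i).
    rewrite /h mdiff_sum (bigD1 (Ordinal nN))//= [X in _ + X]big1 ?addr0; last first.
      move=> k kn; rewrite mdiff_sum big1// => j' _; rewrite mdiff_elementary.
      rewrite ifF//; apply/negbTE; apply: contra kn => /andP[/eqP e _].
      by apply/eqP/val_inj.
    rewrite mdiff_sum (bigD1_seq j)//= [X in _ + X]big1 ?addr0; last first.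
      by move=> j' j'j; rewrite mdiff_elementary idx0_atom_pt eq_sym (negbTE j'j) andbF.
    rewrite mdiff_elementary eqxx idx0_atom_pt eqxx /=.
    rewrite (@cond_mean_eq0 _ _ n.+1 n) ?subr0// => k.
    by case/martingaleP : fm => _ _; apply.
  by rewrite mulrBr (atom_mass_cond_mean_level _ _ (mdiff_level (n := n.+1) fm)) subrr.
rewrite (dual_sum ur fs); apply: eq_bigr => k _.
rewrite (dual_sum ur (fe k)); apply: eq_bigr => j _.
rewrite -unit_integral_dual_diff.
rewrite -(unit_integral_level P j (ltn_ord k) (level_comp2 (fun a b => a * b)
  (mdiff_level (n := k.+1) fm) (@level_dual_diff k.+1))).
by apply: eq_unit_integral => x _; rewrite mdiff_dual.
Qed.

End Duality.

(** * The map from g to its functional: linearity, bijectivity and norm equivalence *)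

Section KappaDuality.
Variables (R : realType) (P : probability (dyadic_line R) R).
Implicit Types (f g h : nat -> dyadic_line R -> R).
Variables (p q p' q' : R).
Hypotheses (hp : 1 < p) (hq : 1 < q).
Hypotheses (hp' : p^-1 + p'^-1 = 1) (hq' : q^-1 + q'^-1 = 1).

Let p0 : 0 < p. Proof. by rewrite (lt_trans _ hp). Qed.
Let q0 : 0 < q. Proof. by rewrite (lt_trans _ hq). Qed.

Lemma kappa_lin_left a g h f : BD_space P p' q' g -> BD_space P p' q' h ->
  G_space P p q f -> kappa P (a *: g + h) f = a * kappa P g f + kappa P h f.
Proof.
move=> [gm gB] [hm hB] [fm fG]; apply: kappa_linear_combination.
- by move=> k x; rewrite /kappa_term mdiffE_lin; ring.
- exact: (kappa_term_integrable hp hq hp' hq').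
- exact: (kappa_term_integrable hp hq hp' hq').
- exact: (kappa_cvg hp hq hp' hq').
- exact: (kappa_cvg hp hq hp' hq').
Qed.

Lemma kappa_lin_right a f h g : BD_space P p' q' g -> G_space P p q f ->
  G_space P p q h -> kappa P g (a *: f + h) = a * kappa P g f + kappa P g h.
Proof.
move=> [gm gB] [fm fG] [hm hG]; apply: kappa_linear_combination.
- by move=> k x; rewrite /kappa_term mdiffE_lin; ring.
- exact: (kappa_term_integrable hp hq hp' hq').
- exact: (kappa_term_integrable hp hq hp' hq').
- exact: (kappa_cvg hp hq hp' hq').
- exact: (kappa_cvg hp hq hp' hq').
Qed.

Lemma sub_lincomb f h : h - f = (-1) *: f + h.
Proof. by rewrite scaleN1r addrC. Qed.

Lemma kappa_in_dual g : BD_space P p' q' g -> G_dual P p q (kappa P g).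
Proof.
move=> gBD; have [gm gB] := gBD; split.
  by move=> a f h fG hG; exact: kappa_lin_right.
move=> f fG e e0; have [fm _] := fG.
set M := fine (BD_norm P p' q' g).
have M0 : 0 <= M by rewrite fine_ge0// BD_norm_ge0.
have M1 : 0 < M + 1 by rewrite ltr_wpDl.
exists (e / (M + 1)); first by rewrite divr_gt0.
move=> h hG hd; have [hm _] := hG.
have hfm : is_martingale P (h - f) by exact: martingale_sub.
have -> : kappa P g h - kappa P g f = kappa P g (h - f).
  by rewrite sub_lincomb kappa_lin_right// mulN1r addrC.
have hfG : (G_norm P p q (h - f)%R < +oo)%E by exact: lt_trans hd (ltry _).
apply: le_lt_trans (kappa_le hp hq hp' hq' hfm gm hfG gB) _; rewrite -/M.
apply: (@le_lt_trans _ _ (e / (M + 1) * M)).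
  rewrite ler_wpM2r// -lee_fin fineK ?ge0_fin_numE ?G_norm_ge0//.
  exact: ltW.
by rewrite mulrAC ltr_pdivrMr// ltr_pM2l// ltrDl.
Qed.

Lemma kappa_eq_as g h f : is_martingale P g -> is_martingale P h ->
  is_martingale P f -> eq_as P g h -> kappa P g f = kappa P h f.
Proof.
move=> gm hm fm gh; rewrite /kappa; congr (limn _); apply/funext => n.
apply: eq_bigr => k _; congr fine; rewrite unlock.
apply: ae_eq_integral => //.
- by apply/measurable_EFinP; apply: measurable_level; exact: (level_kappa_term (k := k) fm gm).
- by apply/measurable_EFinP; apply: measurable_level; exact: (level_kappa_term (k := k) fm hm).
case: k => [|k].
  by apply: aeW => x _ /=; rewrite /kappa_term !mdiff0.
apply: filterS2 (gh k) (gh k.+1) => x e1 e2 _ /=.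
by rewrite /kappa_term !mdiffS e1 e2.
Qed.

(** Testing with the differences of g themselves turns the pairing into a sum of masses times
    squares (d_k g)^2, so all differences up to n vanish on the atoms of positive mass. *)
Lemma kappa_finite_eq0 g n : is_martingale P g ->
  (forall N r f, uniq r -> finite_martingale P N r f -> kappa P g f = 0) ->
  {ae P, forall x, g n x = 0}.
Proof.
move=> gm H.
have z j : unit_integral P n j (fun x => `|g n x|) = 0.
  have := H n [:: j] (test_martingale P n [:: j] (mdiff g)) isT (finite_test _ _ _ _).
  rewrite kappa_test// big_seq1 => z; apply/unit_integral_abs_eq0 => i.
  have [->|wi] := eqVneq (atom_mass P j i) 0; first by rewrite mul0r.
  rewrite (martingale_sum_mdiff n _ gm) big1 ?mulr0// => k _.
  move/eqP: z; rewrite /unit_integral psumr_eq0; last first.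
    move=> l _; rewrite mulr_ge0 ?atom_mass_ge0// sumr_ge0// => m _.
    by rewrite -expr2 sqr_ge0.
  move=> /allP/(_ i); rewrite mem_index_enum => /(_ isT) /=.
  rewrite mulf_eq0 (negbTE wi) /= psumr_eq0; last first.
    by move=> m _; rewrite -expr2 sqr_ge0.
  move=> /allP/(_ k); rewrite mem_index_enum => /(_ isT) /=.
  by rewrite mulf_eq0 orbb => /eqP.
have Lg := martingale_level (n := n) gm.
have mg : measurable_fun [set: dyadic_line R] (fun x => (g n x)%:E).
  by apply/measurable_EFinP; exact: measurable_level Lg.
have I0 : (\int[P]_x `|(g n x)%:E| = 0)%E.
  rewrite (@integral_unit_itvs _ _ (fun x => `|(g n x)%:E|%E))//; last first.
    exact: measurableT_comp.
  apply: esum1 => j _; have := integral_level P j (level_comp (fun a => `|a|) Lg).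
  by rewrite z.
have := (ae_eq_integral_abs P measurableT mg).1 I0.
by apply: filterS => x /(_ I) /= [].
Qed.

Lemma kappa_injective g h : BD_space P p' q' g -> BD_space P p' q' h ->
  (forall f, G_space P p q f -> kappa P g f = kappa P h f) -> eq_as P g h.
Proof.
move=> gB hB H n; have [gm _] := gB; have [hm _] := hB.
have : {ae P, forall x, (g - h) n x = 0}.
  apply: kappa_finite_eq0; first exact: martingale_sub.
  move=> N r f ur ff; have fG := finite_G_space p0 q0 ff ur.
  by rewrite sub_lincomb kappa_lin_left// (H f fG) mulN1r addNr.
by apply: filterS => x /eqP; rewrite subr_eq0 => /eqP.
Qed.

Lemma dual_space_eq phi psi : G_dual P p q phi -> G_dual P p q psi ->
  (forall N r f, uniq r -> finite_martingale P N r f -> phi f = psi f) ->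
  forall f, G_space P p q f -> phi f = psi f.
Proof.
move=> [_ phic] [_ psic] H f fG; apply/eqP; rewrite -subr_eq0 -normr_le0.
apply/ler_addgt0Pr => e e0; rewrite add0r.
have e2 : 0 < e / 2 by rewrite divr_gt0.
have [d1 d10 P1] := phic f fG _ e2; have [d2 d20 P2] := psic f fG _ e2.
have d0 : 0 < Num.min d1 d2 by rewrite lt_min d10.
have [N [r [h [ur hf hd]]]] := finite_martingale_dense hp q0 d0 fG.
have hG := finite_G_space p0 q0 hf ur.
have hd1 : (G_norm P p q (h - f)%R < d1%:E)%E.
  by apply: lt_le_trans hd _; rewrite lee_fin ge_min lexx.
have hd2 : (G_norm P p q (h - f)%R < d2%:E)%E.
  by apply: lt_le_trans hd _; rewrite lee_fin ge_min lexx orbT.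
have := ltW (P1 h hG hd1); have := ltW (P2 h hG hd2).
rewrite (H _ _ _ ur hf) => l2 l1.
have -> : phi f - psi f = (psi h - psi f) - (psi h - phi f) by ring.
by apply: le_trans (ler_normB _ _) _; rewrite (splitr e) lerD.
Qed.

Lemma kappa_surjective phi : G_dual P p q phi ->
  exists2 g, BD_space P p' q' g & forall f, G_space P p q f -> phi f = kappa P g f.
Proof.
move=> phiG; have gm := dual_martingaleP p0 q0 phiG.
set g := dual_martingale P phi in gm *.
have kE N r f : uniq r -> finite_martingale P N r f -> phi f = kappa P g f.
  exact: (dual_finite p0 q0 phiG).
have g0 : G_space P p q 0.
  exact: (finite_G_space p0 q0 (finite_martingale0 P 0 [::])).
(* Continuity at 0 gives |phi f| < 1 on the open ball of radius d; the closed ball of radius d/2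
   inside it fits the non-strict hypothesis of [BD_norm_le_dual]. *)
have [d d0 dP] := phiG.2 0 g0 1 ltr01.
have gBD : BD_space P p' q' g.
  split=> //; apply: (@le_lt_trans _ _ (projection_const p * 1 / (d / 2))%:E); last exact: ltry.
  apply: (BD_norm_le_dual hp hq hp' hq') => //; first by rewrite divr_gt0.
  move=> N r f ur ff fd; rewrite -(kE N r)//; have := dP f (finite_G_space p0 q0 ff ur).
  rewrite subr0 (dual0 p0 q0 phiG) subr0 => H; apply/ltW/H.
  by apply: le_lt_trans fd _; rewrite lte_fin ltr_pdivrMr// ltr_pMr// ltr1n.
exists g => //; apply: dual_space_eq => //; exact: kappa_in_dual.
Qed.

Lemma G_opnorm_ge phi f : G_space P p q f -> (G_norm P p q f <= 1)%E ->
  (`|phi f|%:E <= G_opnorm P p q phi)%E.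
Proof. by move=> fG f1; apply: ereal_sup_ubound; exists f. Qed.

Lemma kappa_opnorm_le g : BD_space P p' q' g ->
  (G_opnorm P p q (kappa P g) <= BD_norm P p' q' g)%E.
Proof.
move=> [gm gB]; apply: ge_ereal_sup => _ [f [[fm fG] f1] <-].
rewrite -[leRHS]fineK ?ge0_fin_numE ?BD_norm_ge0// lee_fin.
apply: le_trans (kappa_le hp hq hp' hq' fm gm fG gB) _.
rewrite ler_piMl ?fine_ge0 ?BD_norm_ge0//.
by rewrite -lee_fin fineK ?ge0_fin_numE ?G_norm_ge0.
Qed.

Lemma kappa_opnorm_ge g : is_martingale P g ->
  ((projection_const p)^-1%:E * BD_norm P p' q' g <= G_opnorm P p q (kappa P g))%E.
Proof.
move=> gm; have c0 := projection_const_gt0 hp.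
have g0 : G_space P p q 0.
  exact: (finite_G_space p0 q0 (finite_martingale0 P 0 [::])).
have n0 : (G_norm P p q 0%R <= 1)%E.
  apply: le_trans (finite_G_norm_le p0 q0 (finite_martingale0 P 0 [::]) isT) _.
  by rewrite /amalgam_sum big_nil powR0 ?lee_fin// invr_neq0// gt_eqF.
have op0 : (0 <= G_opnorm P p q (kappa P g))%E.
  by apply: le_trans (G_opnorm_ge (kappa P g) g0 n0); rewrite lee_fin.
have [->|opfin] := eqVneq (G_opnorm P p q (kappa P g)) +oo%E; first exact: leey.
have opf : G_opnorm P p q (kappa P g) \is a fin_num by rewrite ge0_fin_numE// ltey.
rewrite -(fineK opf) muleC lee_pdivrMr// -EFinM.
have := @BD_norm_le_dual R P p q p' q' hp hq hp' hq' g 1 (fine (G_opnorm P p q (kappa P g))) ltr01.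
rewrite divr1 mulrC; apply=> //; first by rewrite fine_ge0.
move=> N r f ur ff f1; rewrite -lee_fin (fineK opf).
exact: G_opnorm_ge (finite_G_space p0 q0 ff ur) f1.
Qed.

End KappaDuality.

Unset Implicit Arguments.

Theorem theorem3p5 (R : realType) (P : probability (dyadic_line R) R)
    (p q p' q' : R) (hp : 1 < p) (hq : 1 < q)
    (hp' : p^-1 + p'^-1 = 1) (hq' : q^-1 + q'^-1 = 1) :
  (* kappa is well defined: every expectation exists, the series converges *)
  (forall g f, BD_space P p' q' g -> G_space P p q f ->
     (forall k, P.-integrable setT (EFin \o kappa_term g f k)) /\
     cvgn (fun n : nat => \sum_(1 <= k < n) fine 'E_P[kappa_term g f k])) /\
  (* kappa maps BD_{p',q'} into the continuous linear functionals on G_{p,q} *)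
  (forall g, BD_space P p' q' g -> G_dual P p q (kappa P g)) /\
  (* linearity of g |-> kappa_g *)
  (forall (a : R) g h, BD_space P p' q' g -> BD_space P p' q' h ->
     forall f, G_space P p q f ->
       kappa P (a *: g + h) f = a * kappa P g f + kappa P h f) /\
  (* compatibility with a.s. equality, and injectivity *)
  (forall g h, BD_space P p' q' g -> BD_space P p' q' h ->
     (eq_as P g h <-> forall f, G_space P p q f -> kappa P g f = kappa P h f)) /\
  (* surjectivity *)
  (forall phi, G_dual P p q phi ->
     exists2 g, BD_space P p' q' g &
       forall f, G_space P p q f -> phi f = kappa P g f) /\
  (* equivalence of norms *)
  (exists c C : R, [/\ 0 < c, 0 < C &
     forall g, BD_space P p' q' g ->
       (c%:E * BD_norm P p' q' g <= G_opnorm P p q (kappa P g))%E /\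
       (G_opnorm P p q (kappa P g) <= C%:E * BD_norm P p' q' g)%E]).
Proof.
split.
  move=> g f [gm gB] [fm fG]; split.
    exact: (kappa_term_integrable hp hq hp' hq' fm gm fG gB).
  exact: (kappa_cvg hp hq hp' hq' fm gm fG gB).
split; first by move=> g; exact: kappa_in_dual.
split; first by move=> a g h gB hB f fG; exact: (kappa_lin_left hp hq hp' hq').
split.
  move=> g h gB hB; split; last exact: (kappa_injective hp hq hp' hq').
  by move=> gh f [fm _]; have [gm _] := gB; have [hm _] := hB; exact: kappa_eq_as.
split; first by move=> phi; exact: kappa_surjective.
(* The upper constant 1 is that of the two Hoelder inequalities; the lower one depends on p
   alone. *)
exists (projection_const p)^-1, 1; split => //.
  by rewrite invr_gt0 projection_const_gt0.
move=> g gB; split; first by apply: kappa_opnorm_ge => //; case: gB.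
by rewrite mul1e; exact: kappa_opnorm_le.
Qed.
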